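(* Let $\vec p=(1,\infty)$, and let $\vec a,\vec b,\vec c\in\mathbb{R}^2$, $\vec\alpha\in(-1,\infty)^2$. Then the following are equivalent: (1) $S_{\vec a,\vec b,\vec c}$ is bounded from $L^{\vec p}_{\vec\alpha}(T_B\times T_B)$ to $L^\infty(T_B\times T_B)$; (2) $T_{\vec a,\vec b,\vec c}$ is bounded from $L^{\vec p}_{\vec\alpha}(T_B\times T_B)$ to $L^\infty(T_B\times T_B)$; (3) $a_1\ge0$, $a_2>0$, $b_1\ge\alpha_1$, $b_2>-1$, $c_1=a_1+b_1-\alpha_1$, and $c_2=n+1+a_2+b_2$.
   Context: Let $n$ be a positive integer. For $z=(z_1,\dots,z_n)\in\mathbb{C}^n$ write $z=x+iy$ with $x,y\in\mathbb{R}^n$, $z'=(z_1,\dots,z_{n-1})$, $y'=(y_1,\dots,y_{n-1})$. Let $B=\{y\in\mathbb{R}^n: |y'|^2<y_n\}$ and $T_B=\{x+iy: x\in\mathbb{R}^n, y\in B\}$. For $z\in T_B$ put $\rho(z)=y_n-|y'|^2>0$, and for $z,u\in T_B$ put $\rho(z,u)=\frac14\big(\sum_{j=1}^{n-1}(z_j-\overline{u_j})^2-2i(z_n-\overline{u_n})\big)$; this has positive real part, and complex powers $\rho(z,u)^c$ are taken with the principal branch. $dV$ is Lebesgue measure on $\mathbb{C}^n$ and $dV_\alpha(z)=\rho(z)^\alpha dV(z)$. For $\vec p=(p_1,p_2)\in[1,\infty]^2$ and $\vec\alpha=(\alpha_1,\alpha_2)$, $L^{\vec p}_{\vec\alpha}(T_B\times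 T_B)$ is the space of measurable $f$ on $T_B\times T_B$ with finite mixed norm $\|f\|_{\vec p,\vec\alpha}=\big\{\int_{T_B}\big(\int_{T_B}|f(z,w)|^{p_1}dV_{\alpha_1}(z)\big)^{p_2/p_1}dV_{\alpha_2}(w)\big\}^{1/p_2}$, with the inner (resp. outer) integral replaced by an essential supremum in $z$ (resp. $w$) when $p_1=\infty$ (resp. $p_2=\infty$); in particular for $\vec p=(1,\infty)$, $\|f\|=\operatorname{ess\,sup}_{w}\int_{T_B}|f(z,w)|dV_{\alpha_1}(z)$. When $\vec p=(\infty,\infty)$ this is $L^\infty(T_B\times T_B)$. For $\vec a=(a_1,a_2),\vec b=(b_1,b_2),\vec c=(c_1,c_2)\in\mathbb{R}^2$, $T_{\vec a,\vec b,\vec c}f(z,w)=\rho(z)^{a_1}\rho(w)^{a_2}\int_{T_B}\int_{T_B}\frac{\rho(u)^{b_1}\rho(\eta)^{b_2}}{\rho(z,u)^{c_1}\rho(w,\eta)^{c_2}}f(u,\eta)\,dV(u)\,dV(\eta)$ and $S_{\vec a,\vec b,\vec c}f(z,w)=\rho(z)^{a_1}\rho(w)^{a_2}\int_{T_B}\int_{T_B}\frac{\rho(u)^{b_1}\rho(\eta)^{b_2}}{|\rho(z,u)|^{c_1}|\rho(w,\eta)|^{c_2}}f(u,\eta)\,dV(u)\,dV(\eta)$. An operator is bounded from $X$ to $Y$ if for every $f\in X$ the defining integral converges for a.e. $(z,w)$ and $\|Tf\|_Y\le C\|f\|_X$ with $C$ independent of $f$. *)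

(* Defs.v *)
From HB Require Import structures.
From mathcomp Require Import all_boot all_order all_algebra.
From mathcomp Require Import all_classical all_reals all_analysis.
From mathcomp Require Import ess_sup_inf.
From mathcomp.real_closed Require Import complex.

Set Implicit Arguments.
Unset Strict Implicit.
Unset Printing Implicit Defensive.
Import Order.TTheory GRing.Theory Num.Theory.
Import numFieldNormedType.Exports.
Local Open Scope classical_set_scope.
Local Open Scope ring_scope.

(* The carrier: a point z of C^n is an n-tuple of pairs (x_j, y_j), i.e.    *)
(* z_j = x_j + i y_j.  Index j (0-based) ranges over 0..n-1; the paper's    *)
(* z_n is index n.-1 and z' = (z_0, ..., z_{n-2}).                          *)
Definition Cn (R : realType) (n : nat) := n.-tuple (R * R).

Section defs.
Variables (R : realType) (n : nat).

(* j-th complex coordinate z_j = x_j + i y_j *)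
Definition zc (z : Cn R n) (j : nat) : R[i] :=
  let p := nth (0, 0) z j in Complex p.1 p.2.
Definition xc (z : Cn R n) (j : nat) : R := (nth (0, 0) z j).1.
Definition yc (z : Cn R n) (j : nat) : R := (nth (0, 0) z j).2.

(* T_B = { x + i y : |y'|^2 < y_n } *)
Definition TB : set (Cn R n) :=
  [set z | \sum_(j < n.-1) yc z j ^+ 2 < yc z n.-1].

(* rho(z) = y_n - |y'|^2 *)
Definition rho (z : Cn R n) : R := yc z n.-1 - \sum_(j < n.-1) yc z j ^+ 2.

(* rho(z,u) = 1/4 ( sum_{j<n} (z_j - conj u_j)^2 - 2 i (z_n - conj u_n) ) *)
Definition rho2 (z u : Cn R n) : R[i] :=
  4^-1 * (\sum_(j < n.-1) (zc z j - (zc u j)^*) ^+ 2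
          - 2 * 'i * (zc z n.-1 - (zc u n.-1)^*)).

End defs.

(* Real numbers as complex numbers. *)
Definition RtoC (R : realType) (x : R) : R[i] := Complex x 0.

(* Modulus and principal argument of a complex number. *)
Definition cabs (R : realType) (w : R[i]) : R :=
  Num.sqrt (complex.Re w ^+ 2 + complex.Im w ^+ 2).

Definition carg (R : realType) (w : R[i]) : R :=
  let x := complex.Re w in let y := complex.Im w in
  if 0 < x then atan (y / x)
  else if x < 0 then (if 0 <= y then atan (y / x) + pi else atan (y / x) - pi)
  else if 0 < y then pi / 2 else if y < 0 then - (pi / 2) else 0.

(* Principal branch of w^c for real c (w <> 0):
   w^c = exp(c Log w) = |w|^c (cos (c Arg w) + i sin (c Arg w)). *)
Definition cpow (R : realType) (w : R[i]) (c : R) : R[i] :=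
  if w == 0 then 0
  else RtoC (cabs w `^ c) * Complex (cos (c * carg w)) (sin (c * carg w)).

(* Lebesgue measure on C^n = R^{2n}: characterized (uniquely, on the Borel  *)
(* sigma-algebra of the tuple space) by its values on half-open boxes.      *)
Definition is_lebesgue_Cn (R : realType) (n : nat)
    (mu : set (Cn R n) -> \bar R) : Prop :=
  forall a b c d : 'I_n -> R,
    (forall j, a j <= b j) -> (forall j, c j <= d j) ->
    mu [set z : Cn R n | forall j : 'I_n,
          a j < xc z j <= b j /\ c j < yc z j <= d j]
    = (\prod_(j < n) ((b j - a j) * (d j - c j)))%:E.

Section operators.
Variables (R : realType) (n : nat) (mu : {sigma_finite_measure set (Cn R n) -> \bar R}).

Local Notation C2 := (Cn R n * Cn R n)%type.

(* measurability of a complex-valued function on T_B x T_B (ambient space) *)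
Definition cmeasurable (f : C2 -> R[i]) : Prop :=
  measurable_fun setT (fun p => complex.Re (f p)) /\
  measurable_fun setT (fun p => complex.Im (f p)).

(* Lebesgue integrability of a complex-valued function on D w.r.t. dV x dV *)
Definition cintegrable (D : set C2) (g : C2 -> R[i]) : Prop :=
  (mu \x mu)%E.-integrable D (fun p => (complex.Re (g p))%:E) /\
  (mu \x mu)%E.-integrable D (fun p => (complex.Im (g p))%:E).

(* Integral of a complex-valued function over D w.r.t. dV(u) dV(eta) *)
Definition cintegral (D : set C2) (g : C2 -> R[i]) : R[i] :=
  Complex (Rintegral (mu \x mu)%E D (fun p => complex.Re (g p)))
          (Rintegral (mu \x mu)%E D (fun p => complex.Im (g p))).

(* Mixed norm for p = (1, oo):
   ess sup_{w in T_B} int_{T_B} |f(z,w)| rho(z)^alpha1 dV(z).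
   (The essential sup w.r.t. dV_alpha2 restricted to T_B equals the one
    w.r.t. dV restricted to T_B, since rho^alpha2 > 0 there.) *)
Definition mixed_norm_1inf (alpha1 : R) (f : C2 -> R[i]) : \bar R :=
  ess_sup mu (fun w : Cn R n =>
    if w \in @TB R n then
      (\int[mu]_(z in @TB R n) ((cabs (f (z, w)))%:E * (rho z `^ alpha1)%:E))%E
    else 0%E).

(* L^oo(T_B x T_B) norm *)
Definition Linf_norm (g : C2 -> R[i]) : \bar R :=
  ess_sup (mu \x mu)%E (fun p : C2 =>
    if p \in (@TB R n `*` @TB R n) then (cabs (g p))%:E else 0%E).

(* Kernels of T_{a,b,c} and S_{a,b,c} (without the rho(z)^a1 rho(w)^a2 factor) *)
Definition kerT (b c : R * R) (z w u eta : Cn R n) : R[i] :=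
  RtoC ((rho u `^ b.1) * (rho eta `^ b.2))
  / (cpow (rho2 z u) c.1 * cpow (rho2 w eta) c.2).

Definition kerS (b c : R * R) (z w u eta : Cn R n) : R[i] :=
  RtoC ((rho u `^ b.1) * (rho eta `^ b.2)
   / ((cabs (rho2 z u)) `^ c.1 * (cabs (rho2 w eta)) `^ c.2)).

(* integrand (u, eta) |-> K(z,w,u,eta) f(u,eta) at the point p = (z,w) *)
Definition integrand (K : Cn R n -> Cn R n -> Cn R n -> Cn R n -> R[i])
    (f : C2 -> R[i]) (p : C2) : C2 -> R[i] :=
  fun q => K p.1 p.2 q.1 q.2 * f q.

(* The operator: rho(z)^a1 rho(w)^a2 int int K f dV(u) dV(eta) *)
Definition op (a : R * R) (K : Cn R n -> Cn R n -> Cn R n -> Cn R n -> R[i])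
    (f : C2 -> R[i]) (p : C2) : R[i] :=
  RtoC ((rho p.1 `^ a.1) * (rho p.2 `^ a.2))
  * cintegral (@TB R n `*` @TB R n) (integrand K f p).

(* Boundedness from L^{(1,oo)}_alpha(T_B x T_B) to L^oo(T_B x T_B):
   for every f in the source space, the defining integral converges
   (absolutely, in the Lebesgue sense) for a.e. (z,w) in T_B x T_B, and
   ||Tf||_oo <= C ||f||_{p,alpha} with C independent of f. *)
Definition bounded_1inf_to_inf (alpha : R * R) (a : R * R)
    (K : Cn R n -> Cn R n -> Cn R n -> Cn R n -> R[i]) : Prop :=
  exists C : R, forall f : C2 -> R[i],
    cmeasurable f -> (mixed_norm_1inf alpha.1 f < +oo)%E ->
    (\forall p \ae (mu \x mu)%E, (@TB R n `*` @TB R n) p ->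
        cintegrable (@TB R n `*` @TB R n) (integrand K f p))
    /\ (Linf_norm (op a K f) <= C%:E * mixed_norm_1inf alpha.1 f)%E.

End operators.

(* Main.v *)
Require Import Defs.
From HB Require Import structures.
From mathcomp Require Import all_boot all_order all_algebra.
From mathcomp Require Import all_classical all_reals all_analysis.
From mathcomp Require Import ess_sup_inf measurable_realfun.
From mathcomp.real_closed Require Import complex.
From mathcomp Require Import ring lra.
Set Implicit Arguments.
Unset Strict Implicit.
Unset Printing Implicit Defensive.
Import Order.TTheory GRing.Theory Num.Theory.
Import numFieldNormedType.Exports.
Local Open Scope classical_set_scope.
Local Open Scope ring_scope.

(** Writing [z'] for the first [n - 1] coordinates, [Re rho(z,u)] equals
    [(|z' - u'|^2 + 2 rho z + 2 rho u) / 4], so [|rho(z,u)|] dominates both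
    [rho z / 2] and [rho u / 2].

    Sufficiency: by Tonelli the inner [L^1] variable only needs the pointwise
    bound on its kernel, which is the domination above, and the outer variable
    needs the Forelli-Rudin estimate
    [int rho(e)^b / |rho(w,e)|^(n+1+a+b) dV(e) <= C rho(w)^(-a)].  The latter
    is summed over the dyadic layers of [|rho(w,e)|] and [rho(e)]; such a layer
    is a sheared box, whose volume is estimated by cutting it into a fine grid
    of genuine boxes, the only sets on which the measure is prescribed.

    Necessity: test on indicators of products of boxes centred on the imaginary
    axis [z = i r e_n].  There [|Im rho(z,u)|] is small compared with
    [Re rho(z,u)], so the principal power has real part comparable to its
    modulus and T behaves like S.  Letting the scales of the boxes vary gives
    the two homogeneity identities and [a_1 >= 0], [b_1 >= alpha_1]; the strict
    inequalities [a_2 > 0] and [b_2 > -1] come from stacking boxes (resp. layers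
    of the boundary) at all dyadic scales, where equality would make the sum
    diverge. *)

(** * Real and imaginary parts of rho(z,u), and its comparison with rho *)

Section geometry.
Variables (R : realType) (n : nat).
Implicit Types z u : Cn R n.

Definition hdist2 z u : R :=
  \sum_(j < n.-1) ((xc z j - xc u j) ^+ 2 + (yc z j - yc u j) ^+ 2).

(** A Heisenberg-type twist: the imaginary part of rho(z,u) measures the last real coordinates
    relative to it, which is why balls for |rho(z,u)| are sheared. *)
Definition hshear z u : R :=
  \sum_(j < n.-1) (xc z j - xc u j) * (yc z j + yc u j).

(** With [v = Im u_j], the identity [(y + v)^2 = 2 y^2 + 2 v^2 - (y - v)^2] turns the negative
    squares in the real part into [|y' - v'|^2] and exactly the terms that complete the last
    coordinates to [2 rho z + 2 rho u]. *)
Lemma rho2E z u : rho2 z u =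
  Complex (4^-1 * (hdist2 z u + 2 * rho z + 2 * rho u))
          (2^-1 * (hshear z u - (xc z n.-1 - xc u n.-1))).
Proof.
have sumE : \sum_(j < n.-1) (zc z j - (zc u j)^*) ^+ 2 =
  Complex (\sum_(j < n.-1) ((xc z j - xc u j) ^+ 2 - (yc z j + yc u j) ^+ 2))
          (\sum_(j < n.-1) (2 * ((xc z j - xc u j) * (yc z j + yc u j)))).
  elim/big_rec3: _ => [//|j s i r _ ->].
  rewrite /zc -/(xc z j) -/(yc z j) -/(xc u j) -/(yc u j).
  by rewrite expr2; simpc; congr Complex; ring.
have rE : \sum_(j < n.-1) ((xc z j - xc u j) ^+ 2 - (yc z j + yc u j) ^+ 2) =
  hdist2 z u - 2 * \sum_(j < n.-1) yc z j ^+ 2 - 2 * \sum_(j < n.-1) yc u j ^+ 2.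
  rewrite /hdist2 !mulr_sumr -!sumrB; apply: eq_bigr => j _; ring.
rewrite /rho2 sumE rE -mulr_sumr -/(hshear z u).
rewrite /zc -/(xc z n.-1) -/(yc z n.-1) -/(xc u n.-1) -/(yc u n.-1).
have -> : (4^-1 : R[i]) = Complex (4^-1) 0.
  by rewrite -[4]/(4%:R) -(rmorph_nat (real_complex R)) -fmorphV.
have -> : (2 : R[i]) = Complex 2 0.
  by rewrite -[2 in LHS]/(2%:R) -(rmorph_nat (real_complex R)).
have -> : 'i = Complex 0 1 :> R[i] by [].
by simpc; rewrite /rho; congr Complex; field.
Qed.

Lemma Re_rho2 z u :
  complex.Re (rho2 z u) = 4^-1 * (hdist2 z u + 2 * rho z + 2 * rho u).
Proof. by rewrite rho2E. Qed.

Lemma Im_rho2 z u :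
  complex.Im (rho2 z u) = 2^-1 * (hshear z u - (xc z n.-1 - xc u n.-1)).
Proof. by rewrite rho2E. Qed.

Lemma hdist2_ge0 z u : 0 <= hdist2 z u.
Proof. by apply: sumr_ge0 => j _; rewrite addr_ge0 ?sqr_ge0. Qed.

Lemma rho_gt0 z : TB z -> 0 < rho z.
Proof. by rewrite /TB /rho /= subr_gt0. Qed.

Lemma Re_rho2_gt0 z u : TB z -> TB u -> 0 < complex.Re (rho2 z u).
Proof.
move=> /rho_gt0 zB /rho_gt0 uB; rewrite Re_rho2.
by have := hdist2_ge0 z u; lra.
Qed.

Lemma norm_Re_le_cabs (w : R[i]) : `|complex.Re w| <= cabs w.
Proof.
rewrite -sqrtr_sqr ler_sqrt; last by rewrite addr_ge0 ?sqr_ge0.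
by rewrite lerDl sqr_ge0.
Qed.

Lemma Re_le_cabs (w : R[i]) : complex.Re w <= cabs w.
Proof. exact: le_trans (ler_norm _) (norm_Re_le_cabs _). Qed.

Lemma norm_Im_le_cabs (w : R[i]) : `|complex.Im w| <= cabs w.
Proof.
rewrite -sqrtr_sqr ler_sqrt; last by rewrite addr_ge0 ?sqr_ge0.
by rewrite lerDr sqr_ge0.
Qed.

Lemma cabs_le (w : R[i]) : cabs w <= `|complex.Re w| + `|complex.Im w|.
Proof.
rewrite -(ger0_norm (addr_ge0 (normr_ge0 _) (normr_ge0 _))) -sqrtr_sqr.
rewrite ler_sqrt ?sqr_ge0// sqrrD !real_normK ?num_real//.
by rewrite -addrA lerD2l lerDr mulrn_wge0// mulr_ge0.
Qed.

Lemma cabs_ge0 (w : R[i]) : 0 <= cabs w.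
Proof. exact: sqrtr_ge0. Qed.

Lemma rho_le_cabs_l z u : TB z -> TB u -> rho z / 2 <= cabs (rho2 z u).
Proof.
move=> /rho_gt0 zB /rho_gt0 uB; apply: le_trans (Re_le_cabs _).
by rewrite Re_rho2; have := hdist2_ge0 z u; lra.
Qed.

Lemma rho_le_cabs_r z u : TB z -> TB u -> rho u / 2 <= cabs (rho2 z u).
Proof.
move=> /rho_gt0 zB /rho_gt0 uB; apply: le_trans (Re_le_cabs _).
by rewrite Re_rho2; have := hdist2_ge0 z u; lra.
Qed.

Lemma cabs_rho2_gt0 z u : TB z -> TB u -> 0 < cabs (rho2 z u).
Proof. by move=> zB uB; exact: lt_le_trans (Re_rho2_gt0 zB uB) (Re_le_cabs _). Qed.

End geometry.

(** * Measurability of coordinates, rho, rho(z,u) and T_B *)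

Section measurability.
Variables (R : realType) (n : nat).

Lemma measurable_coord j : measurable_fun setT (fun z : Cn R n => nth (0, 0) z j).
Proof.
have [jn|nj] := ltnP j n; last first.
  rewrite (_ : (fun _ => _) = cst (0, 0))//.
  by apply/funext => z; rewrite nth_default// size_tuple.
rewrite (_ : (fun _ => _) = (fun z : n.-tuple (R * R) => tnth z (Ordinal jn))).
  exact: measurable_tnth.
by apply/funext => z; rewrite (tnth_nth (0, 0)).
Qed.

Lemma measurable_xc j : measurable_fun setT (fun z : Cn R n => xc z j).
Proof. exact: measurableT_comp (measurable_coord j). Qed.

Lemma measurable_yc j : measurable_fun setT (fun z : Cn R n => yc z j).
Proof. exact: measurableT_comp (measurable_coord j). Qed.

Lemma measurable_rho : measurable_fun setT (@rho R n).
Proof.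
apply: measurable_funB; first exact: measurable_yc.
by apply: measurable_sum => j; apply: measurable_funX; exact: measurable_yc.
Qed.

Lemma measurable_Re_rho2 z : measurable_fun setT (fun u : Cn R n => complex.Re (rho2 z u)).
Proof.
under eq_fun do rewrite Re_rho2.
apply: measurable_funM => //; apply: measurable_funD; last first.
  by apply: measurable_funM => //; exact: measurable_rho.
apply: measurable_funD => //; apply: measurable_sum => j.
by apply: measurable_funD; apply: measurable_funX; apply: measurable_funB => //;
  [exact: measurable_xc|exact: measurable_yc].
Qed.

Lemma measurable_Im_rho2 z : measurable_fun setT (fun u : Cn R n => complex.Im (rho2 z u)).
Proof.
under eq_fun do rewrite Im_rho2.
apply: measurable_funM => //; apply: measurable_funB.
  apply: measurable_sum => j; apply: measurable_funM.
    by apply: measurable_funB => //; exact: measurable_xc.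
  by apply: measurable_funD => //; exact: measurable_yc.
by apply: measurable_funB => //; exact: measurable_xc.
Qed.

Lemma measurable_cabs d (T : measurableType d) (D : set T) (f : T -> R[i]) :
  measurable_fun D (fun x => complex.Re (f x)) ->
  measurable_fun D (fun x => complex.Im (f x)) ->
  measurable_fun D (fun x => cabs (f x)).
Proof.
move=> mr mi; rewrite /cabs.
under eq_fun do rewrite -powR12_sqrt ?addr_ge0 ?sqr_ge0//.
apply: (@measurableT_comp _ _ _ _ _ _ (@powR R ^~ 2^-1)).
  exact: measurable_powR.
by apply: measurable_funD; exact: measurable_funX.
Qed.

Lemma measurable_TB : measurable (@TB R n).
Proof.
have -> : @TB R n = setT `&` @rho R n @^-1` `]0, +oo[%classic.
  by apply/seteqP; split => z; rewrite /TB /rho /= in_itv/= andbT subr_gt0 ?andTb; tauto.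
exact: measurable_rho.
Qed.

End measurability.

(** * Real powers of comparable quantities *)

Section powR_comparison.
Variable R : realType.
Implicit Types M x X c : R.

(** Monotonicity gives the case of a nonnegative exponent; a negative one follows by inverting the
    bounds for [- c]. The absolute value in the constants lets one statement serve both signs. *)
Lemma powR_comparable M x X c : 1 <= M -> 0 < X -> X / M <= x <= M * X ->
  M `^ (- `|c|) * X `^ c <= x `^ c <= M `^ `|c| * X `^ c.
Proof.
move=> M1 X0 /andP[lx xl]; have M0 : 0 < M by exact: lt_le_trans M1.
have x0 : 0 < x by apply: lt_le_trans lx; exact: divr_gt0.
have key e : 0 <= e -> M `^ (- e) * X `^ e <= x `^ e <= M `^ e * X `^ e.
  move=> e0; have -> : M `^ (- e) = (M^-1) `^ e.
    by rewrite -powR_inv1 ?ltW// -powRrM mulN1r.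
  rewrite -!powRM ?invr_ge0 ?(ltW M0) ?(ltW X0)//; apply/andP; split.
    rewrite [M^-1 * X]mulrC; apply: ge0_ler_powR => //.
      by rewrite nnegrE divr_ge0// ltW.
    by rewrite nnegrE ltW.
  by apply: ge0_ler_powR => //; rewrite nnegrE ?mulr_ge0// ltW.
have [c0|c0] := leP 0 c; first by rewrite ger0_norm//; exact: key.
rewrite ltr0_norm// opprK.
have /andP[k1 k2] : M `^ (- - c) * X `^ (- c) <= x `^ (- c) <= M `^ (- c) * X `^ (- c).
  by apply: key; lra.
move: k1 k2; rewrite opprK !powRN -invfM => k1 k2.
have P y e : 0 < y -> 0 < y `^ e by exact: powR_gt0.
apply/andP; split.
  by move: k2; rewrite lef_pV2 ?posrE ?mulr_gt0 ?P.
by move: k1; rewrite -[X in X / _ <= _]invrK -invfM lef_pV2 ?posrE ?mulr_gt0 ?invr_gt0 ?P.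
Qed.

Lemma powR_addr x (r s : R) : 0 < x -> x `^ (r + s) = x `^ r * x `^ s.
Proof. by move=> x0; rewrite powRD// (gt_eqF x0) implybT. Qed.

Lemma ler_powR_neg (x y c : R) : 0 < x -> x <= y -> 0 <= c -> y `^ (- c) <= x `^ (- c).
Proof.
move=> x0 xy c0; have y0 := lt_le_trans x0 xy.
by rewrite !powRN lef_pV2 ?posrE ?powR_gt0// ge0_ler_powR// nnegrE ltW.
Qed.

Lemma powR_exprn x b k : 0 <= x -> (x ^+ k) `^ b = (x `^ b) ^+ k.
Proof.
move=> x0; elim: k => [|k IH]; first by rewrite !expr0 powR1.
by rewrite !exprS powRM ?exprn_ge0// IH.
Qed.

Lemma powR_invl x b : 0 <= x -> x^-1 `^ b = x `^ (- b).
Proof. by move=> x0; rewrite -powR_inv1// -powRrM mulN1r. Qed.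

Lemma powR2_lt1 (e : R) : 0 < e -> 0 <= (2 : R) `^ (- e) < 1.
Proof.
move=> e0; rewrite powR_ge0 /= powRN invf_lt1 ?powR_gt0//.
by rewrite -[ltLHS](powRr0 2) /powR pnatr_eq0 /= ltr_expR ltr_pM2r// ln_gt0// ltr1n.
Qed.

End powR_comparison.

(** * Measure bounds from finite covers and finite packings *)

Section finite_covers.
Context d (T : measurableType d) (R : realType) (mu : {measure set T -> \bar R}).
Variables (I : finType) (F : I -> set T) (S : set T) (v : R).
Hypothesis mF : forall i, measurable (F i).
Hypothesis mS : measurable S.

(** A cover bounds the measure from above and a packing ([measure_ge_card]) from below by counting
    pieces; the pieces will be boxes standing over the cells of a grid. *)
Lemma measure_le_card : S `<=` \bigcup_i F i ->
  (forall i, mu (F i) <= v%:E)%E -> (mu S <= (#|I|%:R * v)%:E)%E.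
Proof.
move=> SF Fv.
have : (mu S <= \sum_(i \in [set` enum I]) mu (F i))%E.
  apply: content_sub_fsum => //.
  by move=> x /SF[i _ Fix]; exists i => //=; rewrite mem_enum.
rewrite -fsbig_seq ?enum_uniq// => /le_trans; apply.
apply: (@le_trans _ _ (\sum_(i <- enum I) v%:E)%E); first exact: lee_sum.
by rewrite sumEFin big_const_seq count_predT -cardE iter_addr_0 mulr_natl.
Qed.

Lemma measure_ge_card : (forall i, F i `<=` S) -> trivIset setT F ->
  (forall i, v%:E <= mu (F i))%E -> ((#|I|%:R * v)%:E <= mu S)%E.
Proof.
move=> FS tF Fv.
apply: (@le_trans _ _ (mu (\bigcup_(i in [set` enum I]) F i))).
  rewrite measure_fin_bigcup//; last exact: sub_trivIset tF.
  rewrite -fsbig_seq ?enum_uniq//.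
  apply: (@le_trans _ _ (\sum_(i <- enum I) v%:E)%E); last first.
    by apply: lee_sum => i _; exact: Fv.
  by rewrite sumEFin big_const_seq count_predT -cardE iter_addr_0 mulr_natl.
apply: le_measure; rewrite ?inE//.
  exact: fin_bigcup_measurable.
by move=> x [i _ /FS].
Qed.

End finite_covers.

(** * Half-open subdivisions of an interval *)

Section grid.
Variable R : realType.

Lemma grid_cell (a h x : R) N : a < x <= a + N%:R * h ->
  exists k : 'I_N, a + k%:R * h < x <= a + k%:R * h + h.
Proof.
elim: N => [|N IH]; first by rewrite mul0r addr0 => /andP[/lt_le_trans /[apply]]; rewrite ltxx.
move=> /andP[ax xN]; have [xl|xl] := leP x (a + N%:R * h).
  have [|k hk] := IH; first by rewrite ax.
  by exists (widen_ord (leqnSn N) k).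
by exists ord_max; rewrite xl /=; move: xN; rewrite -natr1; lra.
Qed.

Lemma grid_cell_uniq (a h x : R) (k l : nat) : 0 < h ->
  a + k%:R * h < x <= a + k%:R * h + h -> a + l%:R * h < x <= a + l%:R * h + h -> k = l.
Proof.
move=> h0; wlog kl : k l / (k < l)%N => [W hk hl|/andP[_ h1] /andP[h2 _]].
  by have [kl|kl|//] := ltgtP k l; [exact: W|apply/esym; exact: W].
have : k%:R * h + h <= l%:R * h.
  by rewrite -[X in _ + X]mul1r -mulrDl ler_pM2r// natr1 ler_nat.
by move=> h3; exfalso; lra.
Qed.

End grid.

(** * Volumes of boxes and of sheared boxes *)

Section volume.
Variables (R : realType) (m : nat) (mu : {measure set (Cn R m.+1) -> \bar R}).
Hypothesis hmu : is_lebesgue_Cn mu.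
Implicit Types (a c : 'I_m -> R) (h p q : R).

(** Only z' is constrained here and only the last coordinate in [slab], so that the slab can be
    moved with the cell of z' over which it stands. *)
Definition cube a c h : set (Cn R m.+1) :=
  [set z | forall j : 'I_m, a j < xc z j <= a j + h /\ c j < yc z j <= c j + h].

Definition slab p p' q q' : set (Cn R m.+1) :=
  [set z | p < xc z m <= p' /\ q < yc z m <= q'].

Lemma measurable_slab p p' q q' : measurable (slab p p' q q').
Proof.
have -> : slab p p' q q' =
  (setT `&` (fun z : Cn R m.+1 => xc z m) @^-1` `]p, p']%classic) `&`
  (setT `&` (fun z : Cn R m.+1 => yc z m) @^-1` `]q, q']%classic).
  by apply/seteqP; split => z; rewrite /slab /= !in_itv/= => -[? ?]; tauto.
by apply: measurableI; [apply: measurable_xc|apply: measurable_yc].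
Qed.

Lemma measurable_cube a c h : measurable (cube a c h).
Proof.
have -> : cube a c h = \bigcap_(j in [set: 'I_m])
  ((setT `&` (fun z : Cn R m.+1 => xc z j) @^-1` `]a j, a j + h]%classic) `&`
  (setT `&` (fun z : Cn R m.+1 => yc z j) @^-1` `]c j, c j + h]%classic)).
  apply/seteqP; split => z; rewrite /cube /= => H j.
    by have := H j; rewrite /= !in_itv/=; tauto.
  by have := H j I; rewrite /= !in_itv/=; tauto.
apply: fin_bigcap_measurable => // j _.
by apply: measurableI; [apply: measurable_xc|apply: measurable_yc].
Qed.

Lemma mu_cube_slab a c h p p' q q' : 0 <= h -> p <= p' -> q <= q' ->
  mu (cube a c h `&` slab p p' q q') = ((h ^+ 2) ^+ m * ((p' - p) * (q' - q)))%:E.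
Proof.
move=> h0 pp qq.
(* [A f r] extends [f] by the value [r] at the last index, which puts the set in the form whose
   measure is prescribed. *)
pose A (f : 'I_m -> R) (r : R) (j : 'I_m.+1) := if unlift ord_max j is Some i then f i else r.
have Al f r i : A f r (widen_ord (leqnSn m) i) = f i.
  rewrite /A (_ : widen_ord _ i = lift ord_max i) ?liftK//.
  by apply: ord_inj; rewrite lift_max.
have Am f r : A f r ord_max = r by rewrite /A unlift_none.
have -> : cube a c h `&` slab p p' q q' = [set z : Cn R m.+1 | forall j : 'I_m.+1,
   A a p j < xc z j <= A (fun i => a i + h) p' j /\
   A c q j < yc z j <= A (fun i => c i + h) q' j].
  apply/seteqP; split => z /=.
    move=> [H1 H2] j; have [i ->|->] := unliftP ord_max j; last by rewrite !Am; exact: H2.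
    have -> : lift ord_max i = widen_ord (leqnSn m) i by apply: ord_inj; rewrite lift_max.
    by rewrite !Al; exact: H1.
  move=> H; split => [i|].
    by have := H (widen_ord (leqnSn m) i); rewrite !Al.
  by have := H ord_max; rewrite !Am.
rewrite hmu; last 2 first.
- by move=> j; rewrite /A; case: unlift => // i; rewrite lerDl.
- by move=> j; rewrite /A; case: unlift => // i; rewrite lerDl.
congr EFin; rewrite big_ord_recr /= !Am; congr (_ * _).
under eq_bigr do rewrite !Al [X in X - _]addrC addrK [X in _ * (X - _)]addrC addrK -expr2.
by rewrite prodr_const card_ord.
Qed.

Section cells.
Variables (a c : 'I_m -> R) (h : R) (N : nat).
Hypothesis h0 : 0 < h.

Definition cell (k : {ffun 'I_m -> 'I_N * 'I_N}) : set (Cn R m.+1) :=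
  cube (fun j => a j + (k j).1%:R * h) (fun j => c j + (k j).2%:R * h) h.

Lemma cube_cells : cube a c (N%:R * h) `<=` \bigcup_k cell k.
Proof.
move=> z H; have /choice[f hf] : forall j : 'I_m, exists k : 'I_N * 'I_N,
    a j + k.1%:R * h < xc z j <= a j + k.1%:R * h + h /\
    c j + k.2%:R * h < yc z j <= c j + k.2%:R * h + h.
  move=> j; have [/grid_cell[k1 ?] /grid_cell[k2 ?]] := H j.
  by exists (k1, k2).
by exists [ffun j => f j] => // j; rewrite !ffunE.
Qed.

Lemma cell_sub_cube k : cell k `<=` cube a c (N%:R * h).
Proof.
move=> z H j; have [/andP[a1 a2] /andP[c1 c2]] := H j.
have K (i : 'I_N) : 0 <= i%:R * h /\ i%:R * h + h <= N%:R * h.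
  split; first by rewrite mulr_ge0// ltW.
  by rewrite -[X in _ + X]mul1r -mulrDl natr1 ler_pM2r// ler_nat.
by have [[? ?] [? ?]] := (K (k j).1, K (k j).2); split; lra.
Qed.

Lemma trivIset_cell : trivIset setT cell.
Proof.
apply/trivIsetP => k l _ _ /eqP kl; rewrite -subset0 => z [Hk Hl]; apply: kl.
apply/ffunP => j; have [x1 y1] := Hk j; have [x2 y2] := Hl j.
have := grid_cell_uniq h0 x1 x2; have := grid_cell_uniq h0 y1 y2.
by case: (k j) (l j) => [? ?] [? ?] /= /ord_inj -> /ord_inj ->.
Qed.

Lemma card_cells : #|{ffun 'I_m -> 'I_N * 'I_N}| = ((N ^ 2) ^ m)%N.
Proof. by rewrite card_ffun card_prod !card_ord. Qed.

End cells.

(** Over one cell the centre ([phi], [psi]) stays within [p], [q] of a constant, so the part of [S]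
    there lies in a box of half-widths [2 p], [2 q]. These are enlarged to [3 p], [3 q] because
    slabs are open on the left, whence [36 = 6 * 6]. The bound does not depend on how fine the grid
    is. *)
Lemma mu_shear_le (a c : 'I_m -> R) h N (phi psi : Cn R m.+1 -> R) p q
    (P Q : {ffun 'I_m -> 'I_N * 'I_N} -> R) S :
  0 < h -> 0 < p -> 0 < q -> measurable S ->
  (forall k z, cell a c h k z -> `|phi z - P k| <= p /\ `|psi z - Q k| <= q) ->
  (forall z, S z -> cube a c (N%:R * h) z /\
     `|xc z m - phi z| <= p /\ `|yc z m - psi z| <= q) ->
  (mu S <= (((N%:R * h) ^+ 2) ^+ m * (36 * p * q))%:E)%E.
Proof.
move=> h0 p0 q0 mS osc SE.
pose F k := cell a c h k `&` slab (P k - 3 * p) (P k + 3 * p) (Q k - 3 * q) (Q k + 3 * q).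
have -> : ((N%:R * h) ^+ 2) ^+ m * (36 * p * q) =
    #|{ffun 'I_m -> 'I_N * 'I_N}|%:R * ((h ^+ 2) ^+ m * (36 * p * q)).
  by rewrite card_cells !natrX [RHS]mulrA -!exprMn.
apply: (@measure_le_card _ _ _ mu _ F) => //.
- by move=> k; apply: measurableI; [exact: measurable_cube|exact: measurable_slab].
- move=> z /SE[/cube_cells[k _ zk] [xp yq]]; exists k => //; split => //.
  have [pP pQ] := osc _ _ zk.
  by move: xp yq pP pQ; rewrite !ler_norml /slab /= => ? ? ? ?; split; lra.
- move=> k; rewrite mu_cube_slab; [|lra..].
  by rewrite lee_fin ler_wpM2l ?exprn_ge0// ?sqr_ge0//; lra.
Qed.

(** The interval from [psi + q] to [psi + 2 q] moves by at most [q / 4] around its position for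
    [Q k], so its middle half, from [Q k + 5/4 q] to [Q k + 7/4 q], is always inside; this costs the
    factor 1/2. *)
Lemma mu_shear_ge (a c : 'I_m -> R) h N (psi : Cn R m.+1 -> R) p p' q
    (Q : {ffun 'I_m -> 'I_N * 'I_N} -> R) S :
  0 < h -> p <= p' -> 0 < q -> measurable S ->
  (forall k z, cell a c h k z -> `|psi z - Q k| <= q / 4) ->
  (forall z, cube a c (N%:R * h) z -> p < xc z m <= p' ->
     psi z + q < yc z m <= psi z + 2 * q -> S z) ->
  ((((N%:R * h) ^+ 2) ^+ m * ((p' - p) * (q / 2)))%:E <= mu S)%E.
Proof.
move=> h0 pp q0 mS osc SE.
pose F k := cell a c h k `&` slab p p' (Q k + 5 / 4 * q) (Q k + 7 / 4 * q).
have -> : ((N%:R * h) ^+ 2) ^+ m * ((p' - p) * (q / 2)) =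
    #|{ffun 'I_m -> 'I_N * 'I_N}|%:R * ((h ^+ 2) ^+ m * ((p' - p) * (q / 2))).
  by rewrite card_cells !natrX [RHS]mulrA -!exprMn.
apply: (@measure_ge_card _ _ _ mu _ F) => //.
- by move=> k; apply: measurableI; [exact: measurable_cube|exact: measurable_slab].
- move=> k z [zk [xp yq]]; apply: SE => //; first exact: cell_sub_cube zk.
  by have := osc _ _ zk; rewrite ler_norml; lra.
- by apply: trivIset_setIr; exact: trivIset_cell.
- move=> k; rewrite mu_cube_slab; [|lra..].
  rewrite lee_fin; apply: ler_wpM2l; first by rewrite exprn_ge0// sqr_ge0.
  by apply: ler_wpM2l; lra.
Qed.

End volume.

(** * Choice of integers and dyadic scales; oscillation of products and sums *)

Section archimedean_choices.
Variable R : realType.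
Implicit Types x X s : R.

Lemma exists_nat_ge x e : 0 < e -> exists N : nat, (0 < N)%N /\ x <= N%:R * e.
Proof.
move=> e0; exists (Num.bound `|x / e|).+1; split => //.
rewrite -ler_pdivrMr// -natr1.
by have := archi_boundP (normr_ge0 (x / e)); have := ler_norm (x / e); lra.
Qed.

Lemma exists_exp2_gt x : exists k : nat, x < 2 ^+ k.
Proof.
have [N [_]] := exists_nat_ge x (@ltr01 R); rewrite mulr1 => xN; exists N.
by apply: le_lt_trans xN _; rewrite -natrX ltr_nat ltn_expl.
Qed.

(** The least [k] with [X / 2^k < s] works: minimality gives the upper bound, and the assumption
    [s <= 2 X] takes its place when [k = 0]. [dyadic_up] is the increasing counterpart. *)
Lemma dyadic_down X s : 0 < X -> 0 < s <= 2 * X ->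
  exists k : nat, X * 2^-1 ^+ k < s <= 2 * (X * 2^-1 ^+ k).
Proof.
move=> X0 /andP[s0 sX].
have ex : exists k : nat, X * 2^-1 ^+ k < s.
  have [k hk] := exists_exp2_gt (X / s); exists k.
  by rewrite exprVn ltr_pdivrMr ?exprn_gt0// mulrC -ltr_pdivrMr.
case: (ex_minnP ex) => -[|k] hk kmin; first by exists 0%N; rewrite hk expr0 mulr1.
exists k.+1; rewrite hk /= leNgt; apply/negP => h.
have /kmin : X * 2^-1 ^+ k < s by move: h; rewrite exprS; lra.
by rewrite ltnn.
Qed.

Lemma dyadic_up X s : 0 < X -> X / 2 <= s ->
  exists k : nat, X * 2 ^+ k / 2 <= s <= X * 2 ^+ k.
Proof.
move=> X0 Xs.
have ex : exists k : nat, s <= X * 2 ^+ k.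
  have [k hk] := exists_exp2_gt (s / X); exists k.
  by rewrite mulrC -ler_pdivrMr// ltW.
case: (ex_minnP ex) => -[|k] hk kmin; first by exists 0%N; rewrite hk expr0 mulr1 Xs.
exists k.+1; rewrite hk andbT leNgt; apply/negP => h.
have /kmin : s <= X * 2 ^+ k by move: h; rewrite exprS; lra.
by rewrite ltnn.
Qed.

Lemma ler_sum_osc m (F G : 'I_m -> R) e : (forall j, `|F j - G j| <= e) ->
  `|\sum_(j < m) F j - \sum_(j < m) G j| <= m%:R * e.
Proof.
move=> FG; rewrite -sumrB; apply: le_trans (ler_norm_sum _ _ _) _.
by apply: le_trans (ler_sum _ (fun j _ => FG j)) _; rewrite sumr_const card_ord mulr_natl.
Qed.

Lemma sqr_osc x y h A : 0 <= x - y <= h -> `|x| <= A -> `|y| <= A ->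
  `|x ^+ 2 - y ^+ 2| <= 2 * A * h.
Proof.
move=> xy xA yA; have -> : x ^+ 2 - y ^+ 2 = (x + y) * (x - y) by ring.
rewrite normrM; apply: ler_pM => //; last by rewrite ger0_norm; lra.
by apply: le_trans (ler_normD _ _) _; lra.
Qed.

Lemma mulr_osc (u v u' v' h A B : R) : `|u| <= A -> `|v'| <= B ->
  `|u - u'| <= h -> `|v - v'| <= h -> `|u * v - u' * v'| <= (A + B) * h.
Proof.
move=> uA vB uu vv; have -> : u * v - u' * v' = u * (v - v') + (u - u') * v' by ring.
apply: le_trans (ler_normD _ _) _; rewrite !normrM mulrDl; apply: lerD.
  exact: ler_pM.
by rewrite mulrC; apply: ler_pM.
Qed.

End archimedean_choices.

(** * Volumes of balls for |rho(w,z)| and of boundary layers *)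

Section sheared_boxes.
Variables (R : realType) (m : nat) (mu : {measure set (Cn R m.+1) -> \bar R}).
Hypothesis hmu : is_lebesgue_Cn mu.

(** Given z', the point x_n lies within [B] of [xc w m - hshear w z] and y_n within [p] of [|y'|^2].
    Both centres are Lipschitz in z' on the box around w', so a fine enough grid makes their
    oscillation on a cell at most [min B p]. The grid depends on [w], the resulting bound does
    not. *)
Lemma mu_heisenberg_box_le (w : Cn R m.+1) (A B p : R) S :
  0 < A -> 0 < B -> 0 < p -> measurable S ->
  (forall z, S z -> [/\ forall j : 'I_m, `|xc z j - xc w j| < A /\ `|yc z j - yc w j| < A,
     `|hshear w z - (xc w m - xc z m)| <= B & `|rho z| <= p]) ->
  (mu S <= (((2 * A) ^+ 2) ^+ m * (36 * B * p))%:E)%E.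
Proof.
move=> A0 B0 p0 mS SE.
pose Y := \sum_(j < m) `|yc w j|.
have Yj (j : 'I_m) : `|yc w j| <= Y by rewrite /Y (bigD1 j)//= lerDl sumr_ge0.
have Y0 : 0 <= Y by exact: sumr_ge0.
(* A common Lipschitz constant for both centres: the coordinates of y' are at most [A + Y] on the
   box, and the factors of the twist at most [A] and [A + 2 Y]. *)
pose L := m%:R * (2 * A + 2 * Y).
have L0 : 0 <= L by rewrite mulr_ge0//; lra.
have e0 : 0 < Num.min B p by rewrite lt_min B0.
have [N [N0 LN]] := exists_nat_ge (L * (2 * A)) e0.
have NR0 : 0 < N%:R :> R by rewrite ltr0n.
pose h := 2 * A / N%:R.
have h0 : 0 < h by rewrite divr_gt0//; lra.
have Nh : N%:R * h = 2 * A by rewrite /h mulrC divfK// gt_eqF.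
have Lh : L * h <= B /\ L * h <= p.
  have : L * h <= Num.min B p by rewrite /h mulrA ler_pdivrMr// [leRHS]mulrC.
  by rewrite le_min => /andP.
pose a (j : 'I_m) := xc w j - A; pose c (j : 'I_m) := yc w j - A.
pose al (k : {ffun 'I_m -> 'I_N * 'I_N}) j := a j + (k j).1%:R * h.
pose be (k : {ffun 'I_m -> 'I_N * 'I_N}) j := c j + (k j).2%:R * h.
rewrite -Nh; apply: (@mu_shear_le _ _ _ hmu a c h N
  (fun z => xc w m - hshear w z) (fun z => \sum_(j < m) yc z j ^+ 2) B p
  (fun k => xc w m - \sum_(j < m) (xc w j - al k j) * (yc w j + be k j))
  (fun k => \sum_(j < m) be k j ^+ 2)) => //.
  move=> k z zk.
  have zc := cell_sub_cube h0 zk.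
  have H (j : 'I_m) : [/\ `|xc w j - xc z j| <= A, `|yc z j - yc w j| <= A,
      0 <= xc z j - al k j <= h, 0 <= yc z j - be k j <= h & `|be k j - yc w j| <= A].
    have [/andP[x1 x2] /andP[y1 y2]] := zk j; have [] := zc j; rewrite Nh.
    move=> /andP[x3 x4] /andP[y3 y4].
    have : 0 <= (k j).2%:R * h by rewrite mulr_ge0// ltW.
    move: x1 x2 y1 y2 x3 x4 y3 y4; rewrite /al /be /a /c => *.
    by split; rewrite ?ler_norml; lra.
  split.
    apply: (le_trans _ Lh.1); rewrite /hshear /= opprB addrC addrA subrK /L -mulrA.
    apply: ler_sum_osc => j; have [h1 h2 h3 h4 h5] := H j.
    rewrite distrC; have -> : 2 * A + 2 * Y = A + (A + 2 * Y) by ring.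
    apply: mulr_osc => //.
    + move: h5 (Yj j); rewrite !ler_norml => ? ?; lra.
    + by rewrite ler_norml; lra.
    + by rewrite ler_norml; lra.
  apply: (le_trans _ Lh.2); rewrite /L -mulrA.
  apply: ler_sum_osc => j; have [h1 h2 h3 h4 h5] := H j.
  rewrite -mulrDr.
  by apply: sqr_osc => //; move: h2 h5 (Yj j); rewrite !ler_norml => ? ? ?; lra.
move=> z /SE[Hz hB hp]; split; last split.
- move=> j; have [] := Hz j; rewrite Nh !ltr_norml /a /c => ? ?.
  by split; lra.
- by move: hB; rewrite !ler_norml => ?; lra.
- exact: hp.
Qed.

(** A layer at height [q] over a fixed piece of the boundary. As [q] tends to 0 it approaches the
    boundary without shrinking sideways, and its volume is of order [q]. *)
Definition shell (d q : R) : set (Cn R m.+1) :=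
  [set z | (forall j : 'I_m, - d < xc z j <= d /\ - d < yc z j <= d) /\
           - d < xc z m <= d /\ q < rho z <= 2 * q].

Lemma shellE d q : shell d q =
  (cube (fun=> - d) (fun=> - d) (2 * d) `&`
   (setT `&` (fun z : Cn R m.+1 => xc z m) @^-1` `]- d, d]%classic)) `&`
  (setT `&` @rho R m.+1 @^-1` `]q, 2 * q]%classic).
Proof.
have E : - d + 2 * d = d by ring.
by apply/seteqP; split => z; rewrite /shell /cube /= !in_itv/= E; tauto.
Qed.

Lemma measurable_shell d q : measurable (shell d q).
Proof.
rewrite shellE; apply: measurableI; last exact: measurable_rho.
by apply: measurableI; [exact: measurable_cube|exact: measurable_xc].
Qed.

Lemma mu_shell_ge d q : 0 < d -> 0 < q ->
  ((((2 * d) ^+ 2) ^+ m * (d * q))%:E <= mu (shell d q))%E.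
Proof.
move=> d0 q0; pose L := m%:R * (2 * d).
have L0 : 0 <= L by rewrite mulr_ge0//; lra.
have e0 : 0 < q / 4 by lra.
have [N [N0 LN]] := exists_nat_ge (L * (2 * d)) e0.
have NR0 : 0 < N%:R :> R by rewrite ltr0n.
pose h := 2 * d / N%:R.
have h0 : 0 < h by rewrite divr_gt0//; lra.
have Nh : N%:R * h = 2 * d by rewrite /h mulrC divfK// gt_eqF.
have Lh : L * h <= q / 4 by rewrite /h mulrA ler_pdivrMr// [leRHS]mulrC.
have -> : d * q = (d - - d) * (q / 2) by field.
rewrite -Nh; apply: (@mu_shear_ge _ _ _ hmu (fun=> - d) (fun=> - d) h N
  (fun z => \sum_(j < m) yc z j ^+ 2) (- d) d q
  (fun k => \sum_(j < m) (- d + (k j).2%:R * h) ^+ 2)) => //; first lra.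
- exact: measurable_shell.
- move=> k z zk; have zc := cell_sub_cube h0 zk; apply: (le_trans _ Lh).
  rewrite /L -mulrA; apply: ler_sum_osc => j.
  have [_ /andP[y1 y2]] := zk j; have [_] := zc j; rewrite Nh => /andP[y3 y4].
  have : 0 <= (k j).2%:R * h by rewrite mulr_ge0// ltW.
  by move=> ?; apply: sqr_osc; rewrite ?ler_norml; lra.
- move=> z zc xz yz; split => [j|].
    by have := zc j; rewrite Nh => -[? ?]; split; lra.
  by split => //; rewrite /rho /=; lra.
Qed.

(** The real part of rho(w,z) bounds [|z' - w'|^2] by [4 X] and the imaginary part bounds the
    sheared last coordinate by [2 X], so [S] sits in a sheared box with [A = 3 sqrt X], [B = 2 X],
    of height [p]. *)
Lemma mu_ball_le (w : Cn R m.+1) (X p : R) S : 0 < X -> 0 < p -> measurable S ->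
  TB w -> (forall z, S z -> [/\ TB z, cabs (rho2 w z) <= X & rho z <= p]) ->
  (mu S <= (36 ^+ m * 72 * X ^+ m.+1 * p)%:E)%E.
Proof.
move=> X0 p0 mS wB SE.
have -> : 36 ^+ m * 72 * X ^+ m.+1 * p =
    ((2 * (3 * Num.sqrt X)) ^+ 2) ^+ m * (36 * (2 * X) * p).
  have -> : (2 * (3 * Num.sqrt X)) ^+ 2 = 36 * X.
    by rewrite !exprMn sqr_sqrtr ?(ltW X0)//; ring.
  by rewrite exprMn exprS; ring.
apply: (@mu_heisenberg_box_le w) => //; first by rewrite mulr_gt0 ?sqrtr_gt0.
  by rewrite mulr_gt0.
move=> z /SE[zB wzX zp]; have rz := rho_gt0 zB; have rw := rho_gt0 wB.
have ReX := le_trans (Re_le_cabs _) wzX; have ImX := le_trans (norm_Im_le_cabs _) wzX.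
split; last 2 first.
- by move: ImX; rewrite Im_rho2 /= normrM ger0_norm; lra.
- by rewrite ger0_norm// ltW.
move=> j; have dX : hdist2 w z <= 4 * X by move: ReX; rewrite Re_rho2; lra.
have : (xc w j - xc z j) ^+ 2 + (yc w j - yc z j) ^+ 2 <= 4 * X.
  apply: le_trans dX; rewrite /hdist2 (bigD1 j)//= lerDl.
  by apply: sumr_ge0 => i _; rewrite addr_ge0 ?sqr_ge0.
(* The factor 3 in place of 2 makes the inequality strict, as the sheared box requires. *)
have K x : x ^+ 2 <= 4 * X -> `|x| < 3 * Num.sqrt X.
  move=> xX; have sX : 0 < Num.sqrt X by rewrite sqrtr_gt0.
  apply: (@le_lt_trans _ _ (2 * Num.sqrt X)); last lra.
  rewrite -(@ler_pXn2r _ 2) ?nnegrE ?mulr_ge0 ?sqrtr_ge0 ?normr_ge0 //.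
  by rewrite exprMn sqr_sqrtr ?(ltW X0)// real_normK ?num_real//; lra.
have := sqr_ge0 (xc w j - xc z j); have := sqr_ge0 (yc w j - yc z j).
by move=> ? ? ?; split; rewrite distrC; apply: K; lra.
Qed.

End sheared_boxes.

(** * Integrals controlled by geometric series over layers *)

Section geometric_covers.
Context d (T : measurableType d) (R : realType) (mu : {measure set T -> \bar R}).

Lemma nneseries_geometric_le (A q : R) : 0 <= A -> 0 <= q < 1 ->
  (\sum_(k <oo) (A * q ^+ k)%:E <= (A / (1 - q))%:E)%E.
Proof.
move=> A0 /andP[q0 q1]; apply: lime_le.
  by apply: is_cvg_nneseries => k _ _; rewrite lee_fin mulr_ge0// exprn_ge0.
apply: nearW => N; rewrite sumEFin lee_fin.
have -> : \sum_(0 <= k < N) A * q ^+ k = series (geometric A q) N by [].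
rewrite geometric_seriesE ?lt_eqF//= ler_wpM2r ?invr_ge0 ?subr_ge0 ?(ltW q1)//.
by rewrite ler_piMr// gerBl exprn_ge0.
Qed.

(** The layers may overlap: they are made disjoint by [seqDU], and since [F] is nonnegative the
    integrals over the smaller pieces keep the same bounds. *)
Lemma integral_geometric_cover (D : set T) (E : nat -> set T) (F : T -> \bar R) (A q : R) :
  measurable D -> (forall k, measurable (E k)) -> measurable_fun D F ->
  (forall x, D x -> 0 <= F x)%E -> (forall k, E k `<=` D) -> D `<=` \bigcup_k E k ->
  0 <= A -> 0 <= q < 1 ->
  (forall k, \int[mu]_(x in E k) F x <= (A * q ^+ k)%:E)%E ->
  (\int[mu]_(x in D) F x <= (A / (1 - q))%:E)%E.
Proof.
move=> mD mE mF F0 ED DE A0 q01 hE.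
have DU : D = \bigcup_k seqDU E k.
  by rewrite -seqDU_bigcup_eq; apply/seteqP; split => // x [k _ /ED].
have mU k : measurable (seqDU E k).
  by apply: measurableD => //; exact: bigsetU_measurable.
have UE k : seqDU E k `<=` E k by move=> x [].
have := @ge0_integral_bigcup _ _ _ mu (seqDU E) F mU; rewrite -DU /= => -> //.
apply: le_trans (nneseries_geometric_le A0 q01); apply: lee_nneseries => k.
  by move=> _ _; apply: integral_ge0 => x /UE /ED; exact: F0.
move=> _; apply: le_trans (hE k); apply: ge0_subset_integral => //.
  by apply: measurable_funS mF.
by move=> x /ED; exact: F0.
Qed.

Lemma integral_le_bound (D : set T) (f : T -> R) (M V : R) :
  measurable D -> measurable_fun D f -> (forall x, D x -> 0 <= f x <= M) -> 0 <= M ->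
  (mu D <= V%:E)%E -> (\int[mu]_(x in D) (f x)%:E <= (M * V)%:E)%E.
Proof.
move=> mD mf fM M0 DV; apply: (@le_trans _ _ (\int[mu]_(x in D) (cst M%:E x))%E).
  apply: ge0_le_integral => //.
  - by move=> x /fM /andP[]; rewrite lee_fin.
  - exact/measurable_EFinP.
  - by move=> x /fM /andP[]; rewrite lee_fin.
by rewrite integral_cst// EFinM; apply: lee_wpmul2l.
Qed.

End geometric_covers.

(** * The Forelli-Rudin estimate on T_B *)

Section forelli_rudin.
Variables (R : realType) (m : nat) (mu : {measure set (Cn R m.+1) -> \bar R}).
Hypothesis hmu : is_lebesgue_Cn mu.

Definition rball (w : Cn R m.+1) (X : R) : set (Cn R m.+1) :=
  [set z | TB z /\ cabs (rho2 w z) <= X].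

Lemma measurable_cabs_rho2 (w : Cn R m.+1) :
  measurable_fun setT (fun z => cabs (rho2 w z)).
Proof.
by apply: measurable_cabs; [exact: measurable_Re_rho2|exact: measurable_Im_rho2].
Qed.

Lemma measurable_rball w X : measurable (rball w X).
Proof.
have -> : rball w X = @TB R m.+1 `&`
    (setT `&` (fun z => cabs (rho2 w z)) @^-1` `]-oo, X]%classic).
  by apply/seteqP; split => z; rewrite /rball /= in_itv/=; tauto.
by apply: measurableI; [exact: measurable_TB|exact: measurable_cabs_rho2].
Qed.

Lemma measurable_rho_powR (b : R) D : measurable_fun D (fun z : Cn R m.+1 => rho z `^ b).
Proof.
apply: (@measurable_funS _ _ _ _ setT) => //.
apply: (@measurableT_comp _ _ _ _ _ _ (@powR R ^~ b)); first exact: measurable_powR.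
exact: measurable_rho.
Qed.

Lemma measurable_cabs_rho2_powR (w : Cn R m.+1) (c : R) D :
  measurable_fun D (fun z => cabs (rho2 w z) `^ c).
Proof.
apply: (@measurable_funS _ _ _ _ setT) => //.
apply: (@measurableT_comp _ _ _ _ _ _ (@powR R ^~ c)); first exact: measurable_powR.
exact: measurable_cabs_rho2.
Qed.

(** On the ball [rho z <= 2 X], so the layers where [rho z] is of size [X / 2^k] cover it. Such a
    layer has volume at most a constant times [X^(m+2) / 2^k], and its contribution decays with
    ratio [2^(-(1+b))], which is below 1 because [b > -1]. *)
Lemma integral_rball_rho (b : R) : -1 < b -> exists2 C : R, 0 <= C &
  forall w X, TB w -> 0 < X ->
  (\int[mu]_(z in rball w X) (rho z `^ b)%:E <= (C * X `^ (m.+2%:R + b))%:E)%E.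
Proof.
move=> b1; pose K : R := 2 `^ `|b| * (36 ^+ m * 72 * 2).
pose q : R := 2 `^ (- (1 + b)).
have q01 : 0 <= q < 1 by apply: powR2_lt1; lra.
have K0 : 0 <= K by rewrite mulr_ge0 ?powR_ge0// !mulr_ge0// exprn_ge0.
exists (K / (1 - q)); first by rewrite divr_ge0//; lra.
move=> w X wB X0.
pose E k := rball w X `&` (setT `&` @rho R m.+1 @^-1`
   `]X * 2^-1 ^+ k, 2 * (X * 2^-1 ^+ k)]%classic).
have mE k : measurable (E k).
  by apply: measurableI; [exact: measurable_rball|exact: measurable_rho].
have -> : K / (1 - q) * X `^ (m.+2%:R + b) = (K * X `^ (m.+2%:R + b)) / (1 - q) by ring.
apply: (@integral_geometric_cover _ _ _ _ _ E) => //.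
- exact: measurable_rball.
- by apply/measurable_EFinP; exact: measurable_rho_powR.
- by move=> z _; rewrite lee_fin powR_ge0.
- by move=> k z [].
- move=> z zX; have [zB wX] := zX; have rz := rho_gt0 zB.
  have [|k hk] := @dyadic_down R X (rho z) X0.
    by rewrite rz; have := le_trans (rho_le_cabs_r wB zB) wX; lra.
  by exists k => //; split => //; split => //=; rewrite in_itv.
- by rewrite mulr_ge0 ?powR_ge0.
move=> k; have x0 : 0 < X * 2^-1 ^+ k by rewrite mulr_gt0 ?exprn_gt0 ?invr_gt0.
apply: (@le_trans _ _ ((2 `^ `|b| * (X * 2^-1 ^+ k) `^ b) *
    (36 ^+ m * 72 * X ^+ m.+1 * (2 * (X * 2^-1 ^+ k))))%:E).
  apply: integral_le_bound => //.
  - exact: measurable_rho_powR.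
  - move=> z [_ [_]] /=; rewrite in_itv /= => /andP[h1 h2]; rewrite powR_ge0 /=.
    suff /andP[] : 2 `^ (- `|b|) * (X * 2^-1 ^+ k) `^ b <= rho z `^ b <=
        2 `^ `|b| * (X * 2^-1 ^+ k) `^ b by [].
    by apply: powR_comparable => //; lra.
  - by rewrite mulr_ge0 ?powR_ge0.
  - apply: (@mu_ball_le _ _ _ hmu w) => //; first by rewrite mulr_gt0.
    by move=> z [[zB wz] [_]] /=; rewrite in_itv /= => /andP[].
rewrite lee_fin le_eqVlt; apply/orP; left; apply/eqP.
rewrite powRM ?(ltW X0) ?exprn_ge0 ?invr_ge0// powR_exprn ?invr_ge0// powR_invl// /K /q.
rewrite opprD (@powR_addr _ X)// (@powR_addr _ 2)// powR_inv1// exprMn.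
rewrite (@powR_mulrn R X m.+2) ?(ltW X0)//.
by rewrite [X ^+ m.+2]exprS; ring.
Qed.

(** As |rho(w,z)| is at least [rho w / 2], the layers where it is of size [X_k = 2^k rho w],
    [k >= 0], cover T_B. By [integral_rball_rho] each contributes at most a constant times
    [X_k^(-c) X_k^(m+2+b) = X_k^(-a)], summable because [a > 0]. *)
Lemma forelli_rudin (a b : R) : 0 < a -> -1 < b -> exists2 C : R, 0 <= C &
  forall w, TB w ->
  (\int[mu]_(z in @TB R m.+1)
     (rho z `^ b / cabs (rho2 w z) `^ (m.+1%:R + 1 + a + b))%:E
   <= (C * rho w `^ (- a))%:E)%E.
Proof.
move=> a0 b1; have [K K0 hK] := integral_rball_rho b1.
(* Nonnegativity of [c] turns the lower bound [X_k / 2] for |rho(w,z)| on a layer into an upper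
   bound for the kernel. *)
set c := m.+1%:R + 1 + a + b; have c0 : 0 <= c.
  by rewrite /c; have := ler0n R m.+1; lra.
pose q : R := 2 `^ (- a); have q01 : 0 <= q < 1 by exact: powR2_lt1.
exists (2 `^ c * K / (1 - q)).
  by rewrite divr_ge0 ?mulr_ge0 ?powR_ge0//; lra.
move=> w wB; have rw := rho_gt0 wB.
pose X k := rho w * 2 ^+ k.
have X0 k : 0 < X k by rewrite mulr_gt0 ?exprn_gt0.
pose E k := rball w (X k) `&` (setT `&` (fun z => cabs (rho2 w z)) @^-1` `[X k / 2, +oo[%classic).
have mE k : measurable (E k).
  by apply: measurableI; [exact: measurable_rball|exact: measurable_cabs_rho2].
have mF D : measurable_fun D (fun z => rho z `^ b / cabs (rho2 w z) `^ c).
  under eq_fun do rewrite -powRN.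
  by apply: measurable_funM; [exact: measurable_rho_powR|exact: measurable_cabs_rho2_powR].
rewrite mulrAC.
apply: (@integral_geometric_cover _ _ _ _ _ E) => //.
- exact: measurable_TB.
- exact/measurable_EFinP.
- by move=> z _; rewrite lee_fin divr_ge0 ?powR_ge0.
- by move=> k z [[]].
- move=> z zB; have [|k /andP[h1 h2]] := @dyadic_up R (rho w) (cabs (rho2 w z)) rw.
    exact: rho_le_cabs_l.
  by exists k => //; split => //; split => //=; rewrite in_itv/= h1.
- by rewrite !mulr_ge0 ?powR_ge0.
move=> k.
apply: (@le_trans _ _ (\int[mu]_(z in E k) (((X k / 2) `^ (- c))%:E * (rho z `^ b)%:E))%E).
  apply: ge0_le_integral => //.
  - by move=> z _; rewrite lee_fin divr_ge0 ?powR_ge0.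
  - exact/measurable_EFinP.
  - apply/measurable_EFinP; apply: measurable_funM => //; exact: measurable_rho_powR.
  - move=> z [[zB _] [_]] /=; rewrite in_itv/= andbT => h.
    rewrite -EFinM lee_fin mulrC -powRN ler_wpM2r ?powR_ge0// ler_powR_neg//.
    by rewrite divr_gt0.
rewrite ge0_integralZl//; last 3 first.
- by apply/measurable_EFinP; exact: measurable_rho_powR.
- by move=> z _; rewrite lee_fin powR_ge0.
- by rewrite lee_fin powR_ge0.
apply: (@le_trans _ _ (((X k / 2) `^ (- c))%:E * (K * X k `^ (m.+2%:R + b))%:E)%E).
  apply: lee_wpmul2l; first by rewrite lee_fin powR_ge0.
  apply: le_trans (hK _ _ wB (X0 k)); apply: ge0_subset_integral => //.
  - exact: measurable_rball.
  - by apply/measurable_EFinP; exact: measurable_rho_powR.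
  - by move=> z _; rewrite lee_fin powR_ge0.
  - by move=> z [].
rewrite -EFinM lee_fin le_eqVlt; apply/orP; left; apply/eqP.
rewrite powRM ?invr_ge0 ?(ltW (X0 k))// -powR_inv1// -powRrM mulN1r opprK.
have -> : X k `^ (- c) * 2 `^ c * (K * X k `^ (m.+2%:R + b)) =
  2 `^ c * K * X k `^ (- c + (m.+2%:R + b)).
  by rewrite (powR_addr (- c))//; ring.
have -> : - c + (m.+2%:R + b) = - a by rewrite /c -[m.+2%:R]natr1; ring.
by rewrite /X powRM ?(ltW rw)// ?exprn_ge0// powR_exprn// /q; ring.
Qed.

End forelli_rudin.

(** * Modulus and phase of the kernels of S and T *)

Section kernels.
Variables (R : realType) (m : nat).
Local Notation X := (Cn R m.+1).
Local Notation D := (@TB R m.+1 `*` @TB R m.+1).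

Definition kmod (b c : R * R) (z w u e : X) : R :=
  rho u `^ b.1 * rho e `^ b.2 / (cabs (rho2 z u) `^ c.1 * cabs (rho2 w e) `^ c.2).

(* Covers both kernels at once: [th] vanishes for the kernel of S, and where
   [Im rho2] is small relative to [Re rho2] the kernel of T has real part
   comparable to its modulus. *)
Record phase_kernel (b c : R * R) (K : X -> X -> X -> X -> R[i])
    (th : X -> X -> X -> X -> R) : Prop := PhaseKernel {
  phase_kernelE : forall z w u e, TB z -> TB w -> TB u -> TB e ->
    K z w u e = Complex (kmod b c z w u e * cos (th z w u e))
                        (- (kmod b c z w u e * sin (th z w u e)));
  measurable_phase : forall z w, TB z -> TB w ->
    measurable_fun D (fun q => th z w q.1 q.2);
  cos_phase_ge : exists2 eps : R, 0 < eps & forall z w u e,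
    TB z -> TB w -> TB u -> TB e ->
    `|complex.Im (rho2 z u)| <= eps * complex.Re (rho2 z u) ->
    `|complex.Im (rho2 w e)| <= eps * complex.Re (rho2 w e) ->
    2^-1 <= cos (th z w u e) }.

Lemma kerS_phase b c : phase_kernel b c (kerS b c) (fun _ _ _ _ => 0).
Proof.
split => //; first by move=> z w u e *; rewrite cos0 sin0 mulr1 mulr0 oppr0.
by exists 1 => // z w u e *; rewrite cos0; lra.
Qed.

Lemma cpowE (w : R[i]) (c : R) : 0 < complex.Re w ->
  cpow w c = Complex (cabs w `^ c * cos (c * atan (complex.Im w / complex.Re w)))
                     (cabs w `^ c * sin (c * atan (complex.Im w / complex.Re w))).
Proof.
move=> w0; rewrite /cpow /carg w0.
have /negPf -> : w != 0 by apply/eqP => E; move: w0; rewrite E ltxx.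
by rewrite /RtoC; simpc.
Qed.

Lemma div_polar (p A B s t : R) : 0 < A -> 0 < B ->
  RtoC p / (Complex (A * cos s) (A * sin s) * Complex (B * cos t) (B * sin t)) =
  Complex (p / (A * B) * cos (s + t)) (- (p / (A * B) * sin (s + t))).
Proof.
move=> A0 B0.
have E : Complex (A * cos s) (A * sin s) * Complex (B * cos t) (B * sin t) =
    Complex (A * B * cos (s + t)) (A * B * sin (s + t)).
  by simpc; rewrite cosD sinD; congr Complex; ring.
rewrite E; set C := cos _; set S := sin _.
have CS : C ^+ 2 + S ^+ 2 = 1 by exact: cos2Dsin2.
have Z0 : Complex (A * B * C) (A * B * S) != 0.
  apply/eqP => -[/eqP + /eqP]; rewrite !mulf_eq0 (gt_eqF A0) (gt_eqF B0) /= => /eqP C0 /eqP S0.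
  by move/eqP: CS; rewrite C0 S0 expr0n addr0 eq_sym oner_eq0.
apply: (mulIf Z0); rewrite divfK//; simpc; rewrite /RtoC; congr Complex.
  transitivity (p * (C ^+ 2 + S ^+ 2)); first by rewrite CS mulr1.
  by field; rewrite !gt_eqF.
by field; rewrite !gt_eqF.
Qed.

(** An argument of the denominator of the kernel of T, not reduced modulo 2 pi; each principal
    argument is an arctangent since the real parts are positive on T_B. *)
Definition phaseT (c : R * R) (z w u e : X) : R :=
  c.1 * atan (complex.Im (rho2 z u) / complex.Re (rho2 z u)) +
  c.2 * atan (complex.Im (rho2 w e) / complex.Re (rho2 w e)).

Lemma cos_phase_near (c : R * R) : exists2 eps : R, 0 < eps &
  forall s t, `|s| <= eps -> `|t| <= eps -> 2^-1 <= cos (c.1 * atan s + c.2 * atan t).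
Proof.
have [dl dl0 hdl] : exists2 dl : R, 0 < dl & forall x, `|x| < dl -> 2^-1 <= cos x.
  have /cvgrPdist_lt /(_ 2^-1) := @continuous_cos R 0.
  rewrite invr_gt0 ltr0n => /(_ isT) /nbhs_ballP[dl /= dl0 H].
  exists dl => // x xd; have := H x; rewrite /ball /= sub0r normrN => /(_ xd).
  by rewrite cos0 ltr_norml; lra.
(* The added 1 keeps [M] positive when [c = 0] and makes the final comparison with [dl] strict. *)
pose M := `|c.1| + `|c.2| + 1; have M0 : 0 < M.
  by rewrite /M; have := normr_ge0 c.1; have := normr_ge0 c.2; lra.
have [e e0 he] : exists2 e : R, 0 < e & forall x, `|x| <= e -> `|atan x| < dl / M.
  have /cvgrPdist_lt /(_ (dl / M)) := @continuous_atan R 0.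
  rewrite divr_gt0// => /(_ isT) /nbhs_ballP[e /= e0 H].
  exists (e / 2) => [|x xe]; first by rewrite divr_gt0.
  have := H x; rewrite /ball /= sub0r normrN atan0 sub0r normrN; apply.
  by rewrite (le_lt_trans xe)// ltr_pdivrMr// ltr_pMr// ltr1n.
exists e => // s t /he hs /he ht; apply: hdl.
apply: (le_lt_trans (ler_normD _ _)); rewrite !normrM.
apply: (@le_lt_trans _ _ ((`|c.1| + `|c.2|) * (dl / M))).
  by rewrite mulrDl; apply: lerD; apply: ler_wpM2l => //; exact: ltW.
by rewrite mulrA ltr_pdivrMr// [ltRHS]mulrC ltr_pM2r// /M ltrDl.
Qed.

Lemma measurable_arg (z : X) : TB z -> measurable_fun (@TB R m.+1)
  (fun u => atan (complex.Im (rho2 z u) / complex.Re (rho2 z u))).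
Proof.
(* The inverse is replaced by the power -1, with which it agrees because Re rho(z,u) is positive on
   T_B. *)
move=> zB; apply: (@eq_measurable_fun _ _ _ _ _
  (fun u => atan (complex.Im (rho2 z u) * complex.Re (rho2 z u) `^ (-1)))).
  move=> u; rewrite inE => uB; rewrite powR_inv1//.
  exact/ltW/Re_rho2_gt0.
apply: (@measurable_funS _ _ _ _ setT) => //.
apply: (@measurableT_comp _ _ _ _ _ _ (@atan R)).
  by apply: continuous_measurable_fun => x; exact: continuous_atan.
apply: measurable_funM; first exact: measurable_Im_rho2.
apply: (@measurableT_comp _ _ _ _ _ _ (@powR R ^~ (-1))); first exact: measurable_powR.
exact: measurable_Re_rho2.
Qed.

Lemma measurable_D : measurable D.
Proof. by apply: measurableX; exact: measurable_TB. Qed.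

Lemma measurable_fun_pr1 (f : X -> R) :
  measurable_fun (@TB R m.+1) f -> measurable_fun D (fun q => f q.1).
Proof.
move=> mf; apply: (measurable_comp _ _ mf); first exact: measurable_TB.
  by move=> _ [q [? _] <-].
by apply: (@measurable_funS _ _ _ _ setT) => //; exact: measurable_fst.
Qed.

Lemma measurable_fun_pr2 (f : X -> R) :
  measurable_fun (@TB R m.+1) f -> measurable_fun D (fun q => f q.2).
Proof.
move=> mf; apply: (measurable_comp _ _ mf); first exact: measurable_TB.
  by move=> _ [q [_ ?] <-].
by apply: (@measurable_funS _ _ _ _ setT) => //; exact: measurable_snd.
Qed.

Lemma kerT_phase b c : phase_kernel b c (kerT b c) (phaseT c).
Proof.
split.
- move=> z w u e zB wB uB eB; rewrite /kerT !cpowE ?Re_rho2_gt0//.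
  by rewrite div_polar// powR_gt0// cabs_rho2_gt0.
- move=> z w zB wB; apply: measurable_funD; apply: measurable_funM => //.
    exact: (measurable_fun_pr1 (measurable_arg zB)).
  exact: (measurable_fun_pr2 (measurable_arg wB)).
- have [eps eps0 H] := cos_phase_near c; exists eps => // z w u e zB wB uB eB h1 h2.
  have K (s t : X) : TB s -> TB t ->
      `|complex.Im (rho2 s t)| <= eps * complex.Re (rho2 s t) ->
      `|complex.Im (rho2 s t) / complex.Re (rho2 s t)| <= eps.
    move=> sB tB; have r0 := Re_rho2_gt0 sB tB.
    by rewrite normrM normfV (gtr0_norm r0) ler_pdivrMr.
  by apply: H; exact: K.
Qed.

Lemma kmod_ge0 b c z w u e : 0 <= kmod b c z w u e.
Proof. by rewrite divr_ge0// mulr_ge0// powR_ge0. Qed.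

Lemma measurable_kmod b c z w : measurable_fun D (fun q => kmod b c z w q.1 q.2).
Proof.
rewrite /kmod; under eq_fun do rewrite invfM -!powRN.
apply: measurable_funM; apply: measurable_funM.
- by apply: (@measurable_fun_pr1 (fun u => rho u `^ b.1)); exact: measurable_rho_powR.
- by apply: (@measurable_fun_pr2 (fun u => rho u `^ b.2)); exact: measurable_rho_powR.
- by apply: (@measurable_fun_pr1 (fun u => cabs (rho2 z u) `^ (- c.1))); exact: measurable_cabs_rho2_powR.
- by apply: (@measurable_fun_pr2 (fun u => cabs (rho2 w u) `^ (- c.2))); exact: measurable_cabs_rho2_powR.
Qed.

End kernels.

(** * Sufficiency of the exponent conditions *)

Section sufficiency.
Variables (R : realType) (m : nat).
Local Notation X := (Cn R m.+1).
Local Notation D := (@TB R m.+1 `*` @TB R m.+1).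
Variable mu : {sigma_finite_measure set X -> \bar R}.
Hypothesis hmu : is_lebesgue_Cn mu.

(** Both [rho z] and [rho u] are at most [2 |rho(z,u)|]; raise these to the nonnegative powers [a]
    and [b - al] and multiply. The factor [rho u ^ al] left over is the weight of the source
    norm. *)
Lemma kernel1_le (a b al : R) (z u : X) : 0 <= a -> al <= b -> TB z -> TB u ->
  rho u `^ b / cabs (rho2 z u) `^ (a + b - al) <=
  2 `^ (a + b - al) * rho z `^ (- a) * rho u `^ al.
Proof.
move=> a0 alb zB uB; have rz := rho_gt0 zB; have ru := rho_gt0 uB.
have k0 := cabs_rho2_gt0 zB uB; set k := cabs _ in k0 *.
rewrite ler_pdivrMr ?powR_gt0//.
have -> : 2 `^ (a + b - al) * rho z `^ (- a) * rho u `^ al * k `^ (a + b - al) =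
  (2 * k) `^ (a + b - al) * rho z `^ (- a) * rho u `^ al.
  by rewrite powRM// ?(ltW k0)//; ring.
have -> : rho u `^ b = rho z `^ a * rho u `^ (b - al) * rho z `^ (- a) * rho u `^ al.
  rewrite (@powR_addr _ _ b (- al))// !powRN.
  by field; rewrite !gt_eqF// powR_gt0.
rewrite !ler_pM2r ?powR_gt0// -addrA (@powR_addr _ (2 * k)); last by rewrite mulr_gt0.
have h1 := rho_le_cabs_l zB uB; have h2 := rho_le_cabs_r zB uB.
apply: ler_pM; rewrite ?powR_ge0//; apply: ge0_ler_powR; rewrite ?nnegrE ?subr_ge0//.
- exact: ltW.
- by rewrite mulr_ge0// ltW.
- by rewrite -/k in h1; lra.
- exact: ltW.
- by rewrite mulr_ge0// ltW.
- by rewrite -/k in h2; lra.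
Qed.

(** A measure that is not zero is what makes the essential supremum of a nonnegative function
    nonnegative. *)
Lemma mu_setT_gt0 : (0 < mu [set: X])%E.
Proof.
have := @mu_cube_slab R m mu hmu (fun=> 0) (fun=> 0) 1 0 1 0 1.
rewrite !subr0 !mulr1 !expr1n => E.
apply: (@lt_le_trans _ _ 1%E) => //.
rewrite -[1%E]/((1 : R)%:E) -E//; apply: le_measure; rewrite ?inE//.
by apply: measurableI; [exact: measurable_cube|exact: measurable_slab].
Qed.

Lemma mixed_norm_ge0 al f : (0 <= mixed_norm_1inf mu al f)%E.
Proof.
apply: ess_sup_gee; first exact: mu_setT_gt0.
apply: nearW => w; case: ifP => // _; apply: integral_ge0 => z _.
by rewrite mule_ge0// lee_fin ?powR_ge0 ?cabs_ge0.
Qed.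

Lemma mixed_norm_ae al f : \forall w \ae mu, TB w ->
  (\int[mu]_(z in @TB R m.+1) ((cabs (f (z, w)))%:E * (rho z `^ al)%:E) <=
   mixed_norm_1inf mu al f)%E.
Proof.
have := ess_sup_ge mu (fun w : X => if w \in @TB R m.+1 then
  (\int[mu]_(z in @TB R m.+1) ((cabs (f (z, w)))%:E * (rho z `^ al)%:E))%E else 0%E).
by apply: filterS => w /= H wB; move: H; rewrite mem_set.
Qed.

Section fubini_D.
Variable g : X * X -> R.
Hypothesis g0 : forall q, D q -> 0 <= g q.
Hypothesis mg : measurable_fun D g.
Let gD := (EFin \o g) \_ D.

Let gD0 q : (0 <= gD q)%E.
Proof. by apply: erestrict_ge0 => {}q /g0; rewrite lee_fin. Qed.

Let mgD : measurable_fun setT gD.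
Proof.
apply/(measurable_restrictT _ _).1; first exact: measurable_D.
exact/measurable_EFinP.
Qed.

Lemma fubini_G_D e : fubini_G mu gD e =
  if e \in @TB R m.+1 then (\int[mu]_(u in @TB R m.+1) (g (u, e))%:E)%E else 0%E.
Proof.
rewrite /fubini_G /gD; case: ifPn => eB.
  rewrite [RHS]integral_mkcond; apply: eq_integral => u _; rewrite !patchE.
  by rewrite in_setX /= eB andbT.
by rewrite integral0_eq// => u _; rewrite patchE in_setX /= (negPf eB) andbF.
Qed.

(** Tonelli for the extension of [g] by zero, with the second variable outermost as in the mixed
    norm. *)
Lemma integral_D : (\int[(mu \x mu)%E]_(q in D) (g q)%:E =
   \int[mu]_(e in @TB R m.+1) \int[mu]_(u in @TB R m.+1) (g (u, e))%:E)%E.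
Proof.
rewrite integral_mkcond (fubini_tonelli2 gD mgD gD0) [RHS]integral_mkcond.
by apply: eq_integral => e _; rewrite fubini_G_D patchE.
Qed.

Lemma measurable_integral_D : measurable_fun (@TB R m.+1)
  (fun e => \int[mu]_(u in @TB R m.+1) (g (u, e))%:E)%E.
Proof.
apply: (@eq_measurable_fun _ _ _ _ _ (fubini_G mu gD)).
  by move=> e eB; rewrite fubini_G_D eB.
apply: (@measurable_funS _ _ _ _ setT) => //.
exact: measurable_fun_fubini_tonelli_G.
Qed.

End fubini_D.

Lemma measurable_section (f : X * X -> R[i]) (e : X) : cmeasurable f ->
  measurable_fun setT (fun u => cabs (f (u, e))).
Proof.
move=> [mr mi]; apply: (@measurableT_comp _ _ _ _ _ _ (fun q => cabs (f q))).
  exact: measurable_cabs.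
exact: measurable_pair2.
Qed.

(** For fixed [e] the pointwise bound [kernel1_le] reduces the integral in [u] to the inner integral
    of the mixed norm; what remains in [e] is the Forelli-Rudin integral. *)
Lemma integral_kmod_le (a b c alpha : R * R) : 0 <= a.1 -> 0 < a.2 -> alpha.1 <= b.1 ->
  -1 < b.2 -> c.1 = a.1 + b.1 - alpha.1 -> c.2 = m.+1%:R + 1 + a.2 + b.2 ->
  exists2 C : R, 0 <= C & forall f, cmeasurable f ->
    (mixed_norm_1inf mu alpha.1 f < +oo)%E -> forall z w, TB z -> TB w ->
    (\int[(mu \x mu)%E]_(q in D) (kmod b c z w q.1 q.2 * cabs (f q))%:E <=
     (C * (rho z `^ (- a.1) * rho w `^ (- a.2)))%:E * mixed_norm_1inf mu alpha.1 f)%E.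
Proof.
move=> a10 a20 ab b21 c1E c2E; have [C C0 hC] := forelli_rudin hmu a20 b21.
exists (2 `^ c.1 * C) => [|f mf Mfin z w zB wB]; first by rewrite mulr_ge0 ?powR_ge0.
have M0 := mixed_norm_ge0 alpha.1 f.
have ae := mixed_norm_ae alpha.1 f.
set M := mixed_norm_1inf _ _ _ in M0 Mfin ae *.
have Mf : M \is a fin_num by rewrite ge0_fin_numE.
have [mr mi] := mf.
have mg : measurable_fun D (fun q => kmod b c z w q.1 q.2 * cabs (f q)).
  apply: measurable_funM; first exact: measurable_kmod.
  by apply: (@measurable_funS _ _ _ _ setT) => //; exact: measurable_cabs.
have g0 q : D q -> 0 <= kmod b c z w q.1 q.2 * cabs (f q).
  by move=> _; rewrite mulr_ge0 ?kmod_ge0 ?cabs_ge0.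
rewrite integral_D//.
pose kap e := 2 `^ c.1 * rho z `^ (- a.1) * (rho e `^ b.2 / cabs (rho2 w e) `^ c.2).
have kap0 e : 0 <= kap e by rewrite mulr_ge0 ?divr_ge0 ?mulr_ge0 ?powR_ge0.
have mTB := @measurable_TB R m.+1.
have mk2 : measurable_fun (@TB R m.+1) (fun e => rho e `^ b.2 / cabs (rho2 w e) `^ c.2).
  under eq_fun do rewrite -powRN.
  by apply: measurable_funM; [exact: measurable_rho_powR|exact: measurable_cabs_rho2_powR].
have inner e : TB e -> (\int[mu]_(u in @TB R m.+1) (kmod b c z w u e * cabs (f (u, e)))%:E <=
   (kap e)%:E * \int[mu]_(u in @TB R m.+1) ((cabs (f (u, e)))%:E * (rho u `^ alpha.1)%:E))%E.
  move=> eB; have mfe := measurable_section e mf.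
  have mfe' : measurable_fun (@TB R m.+1) (fun u => cabs (f (u, e))).
    exact: (@measurable_funS _ _ _ _ setT).
  rewrite -ge0_integralZl//; last 3 first.
  - apply/measurable_EFinP; apply: measurable_funM => //; exact: measurable_rho_powR.
  - by move=> u _; rewrite lee_fin mulr_ge0 ?powR_ge0 ?cabs_ge0.
  - by rewrite lee_fin.
  apply: ge0_le_integral => //.
  - by move=> u _; rewrite lee_fin mulr_ge0 ?kmod_ge0 ?cabs_ge0.
  - apply/measurable_EFinP; apply: measurable_funM => //.
    rewrite /kmod; under eq_fun do rewrite invfM -!powRN.
    apply: measurable_funM; apply: measurable_funM => //.
    + exact: measurable_rho_powR.
    + exact: measurable_cabs_rho2_powR.
  - apply/measurable_EFinP; apply: measurable_funM => //; apply: measurable_funM => //.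
    exact: measurable_rho_powR.
  - move=> u uB; rewrite -!EFinM lee_fin.
    have -> : kmod b c z w u e = rho u `^ b.1 / cabs (rho2 z u) `^ c.1 *
        (rho e `^ b.2 / cabs (rho2 w e) `^ c.2).
      by rewrite /kmod invfM mulrACA.
    have -> : kap e * (cabs (f (u, e)) * rho u `^ alpha.1) =
       2 `^ c.1 * rho z `^ (- a.1) * rho u `^ alpha.1 *
        (rho e `^ b.2 / cabs (rho2 w e) `^ c.2) * cabs (f (u, e)) by rewrite /kap; ring.
    apply: ler_wpM2r; first exact: cabs_ge0.
    apply: ler_wpM2r; first by rewrite divr_ge0 ?powR_ge0.
    by rewrite c1E; exact: kernel1_le.
(* The inner integral is bounded by the essential supremum [M] only for almost every [e], hence the
   almost everywhere comparison. *)
apply: (@le_trans _ _ (\int[mu]_(e in @TB R m.+1) ((kap e)%:E * M))%E).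
  apply: ae_ge0_le_integral => //.
  - move=> e _; apply: integral_ge0 => u _.
    by rewrite lee_fin mulr_ge0 ?kmod_ge0 ?cabs_ge0.
  - exact: (measurable_integral_D g0 mg).
  - by move=> e _; rewrite mule_ge0// lee_fin.
  - under eq_fun do rewrite -(fineK Mf) -EFinM.
    by apply/measurable_EFinP; do 2 apply: measurable_funM => //.
  - apply: filterS ae => e H eB; apply: (le_trans (inner e eB)).
    by apply: lee_wpmul2l; [rewrite lee_fin|exact: H].
rewrite -(fineK Mf).
have E e : ((kap e)%:E * (fine M)%:E)%E = ((2 `^ c.1 * rho z `^ (- a.1) * fine M)%:E *
    (rho e `^ b.2 / cabs (rho2 w e) `^ c.2)%:E)%E.
  by rewrite -!EFinM /kap; congr EFin; ring.
under eq_integral do rewrite E.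
have M'0 : 0 <= fine M by exact: fine_ge0.
rewrite ge0_integralZl//; last 3 first.
- exact/measurable_EFinP.
- by move=> e _; rewrite lee_fin divr_ge0 ?powR_ge0.
- by rewrite lee_fin !mulr_ge0 ?powR_ge0.
have -> : ((2 `^ c.1 * C * (rho z `^ (- a.1) * rho w `^ (- a.2)))%:E * (fine M)%:E =
  (2 `^ c.1 * rho z `^ (- a.1) * fine M)%:E * (C * rho w `^ (- a.2))%:E)%E.
  by rewrite -!EFinM; congr EFin; ring.
apply: lee_wpmul2l; first by rewrite lee_fin !mulr_ge0 ?powR_ge0.
by rewrite c2E; exact: hC.
Qed.

(** * Convergence and size of the operator integral for a general phase *)

Variables (b c : R * R) (K : X -> X -> X -> X -> R[i]) (th : X -> X -> X -> X -> R).
Hypothesis hK : phase_kernel b c K th.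

Section integrand.
Variables (f : X * X -> R[i]) (p : X * X).
Hypotheses (mf : cmeasurable f) (pD : D p).

Let k q := kmod b c p.1 p.2 q.1 q.2.
Let t q := th p.1 p.2 q.1 q.2.

Lemma Re_integrand q : D q -> complex.Re (integrand K f p q) =
  k q * cos (t q) * complex.Re (f q) + k q * sin (t q) * complex.Im (f q).
Proof.
case: pD => p1 p2 [q1 q2]; rewrite /integrand (phase_kernelE hK)//.
by case: (f q) => x y; simpc => /=; rewrite -/(k q) -/(t q); ring.
Qed.

Lemma Im_integrand q : D q -> complex.Im (integrand K f p q) =
  k q * cos (t q) * complex.Im (f q) - k q * sin (t q) * complex.Re (f q).
Proof.
case: pD => p1 p2 [q1 q2]; rewrite /integrand (phase_kernelE hK)//.
by case: (f q) => x y; simpc => /=; rewrite -/(k q) -/(t q); ring.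
Qed.

Lemma cabs_integrand q : D q -> cabs (integrand K f p q) = k q * cabs (f q).
Proof.
move=> qD; rewrite /cabs Re_integrand// Im_integrand//.
rewrite -[k q in RHS]ger0_norm ?kmod_ge0// -sqrtr_sqr -sqrtrM ?sqr_ge0//.
have CS := cos2Dsin2 (t q); congr Num.sqrt.
transitivity (k q ^+ 2 * (cos (t q) ^+ 2 + sin (t q) ^+ 2) *
  (complex.Re (f q) ^+ 2 + complex.Im (f q) ^+ 2)); first by ring.
by rewrite CS mulr1.
Qed.

Let mk : measurable_fun D k.
Proof. exact: measurable_kmod. Qed.

Let mt : measurable_fun D t.
Proof. by case: pD => *; exact: (measurable_phase hK). Qed.

Let mcos : measurable_fun D (fun q => cos (t q)).
Proof.
apply: (@measurableT_comp _ _ _ _ _ _ (@cos R)) => //.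
by apply: continuous_measurable_fun => x; exact: continuous_cos.
Qed.

Let msin : measurable_fun D (fun q => sin (t q)).
Proof.
apply: (@measurableT_comp _ _ _ _ _ _ (@sin R)) => //.
by apply: continuous_measurable_fun => x; exact: continuous_sin.
Qed.

Let mfr : measurable_fun D (fun q => complex.Re (f q)).
Proof. by apply: (@measurable_funS _ _ _ _ setT) => //; case: mf. Qed.

Let mfi : measurable_fun D (fun q => complex.Im (f q)).
Proof. by apply: (@measurable_funS _ _ _ _ setT) => //; case: mf. Qed.

Lemma measurable_Re_integrand :
  measurable_fun D (fun q => complex.Re (integrand K f p q)).
Proof.
apply: (@eq_measurable_fun _ _ _ _ _ (fun q => k q * cos (t q) * complex.Re (f q) +
   k q * sin (t q) * complex.Im (f q))).
  by move=> q; rewrite inE => qD; rewrite Re_integrand.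
by apply: measurable_funD; do 2 apply: measurable_funM => //.
Qed.

Lemma measurable_Im_integrand :
  measurable_fun D (fun q => complex.Im (integrand K f p q)).
Proof.
apply: (@eq_measurable_fun _ _ _ _ _ (fun q => k q * cos (t q) * complex.Im (f q) -
   k q * sin (t q) * complex.Re (f q))).
  by move=> q; rewrite inE => qD; rewrite Im_integrand.
by apply: measurable_funB; do 2 apply: measurable_funM => //.
Qed.

Variable B : R.
Hypothesis hB : (\int[(mu \x mu)%E]_(q in D) (k q * cabs (f q))%:E <= B%:E)%E.

Lemma dominated_integrable (g : X * X -> R) : measurable_fun D g ->
  (forall q, D q -> `|g q| <= cabs (integrand K f p q)) ->
  (mu \x mu)%E.-integrable D (fun q => (g q)%:E) /\ `|Rintegral (mu \x mu)%E D g| <= B.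
Proof.
move=> mg gK; have mD : measurable D by exact: measurable_D.
have mkf : measurable_fun D (fun q => k q * cabs (f q)).
  by apply: measurable_funM => //; exact: measurable_cabs.
have le : (\int[(mu \x mu)%E]_(q in D) `|(g q)%:E| <= B%:E)%E.
  apply: le_trans hB; apply: ge0_le_integral => //.
  - by apply: measurableT_comp => //; exact/measurable_EFinP.
  - exact/measurable_EFinP.
  - by move=> q qD /=; rewrite lee_fin -cabs_integrand//; exact: gK.
have ig : (mu \x mu)%E.-integrable D (fun q => (g q)%:E).
  apply/integrableP; split; first exact/measurable_EFinP.
  by apply: le_lt_trans le _; rewrite ltry.
split => //; rewrite -lee_fin EFin_normr_Rintegral//.
apply: le_trans le; apply: le_abse_integral => //; exact/measurable_EFinP.
Qed.

(** Real and imaginary parts are each dominated by the modulus of the integrand; adding the two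
    bounds gives the factor 2. *)
Lemma cintegrable_cintegral_le : cintegrable mu D (integrand K f p) /\
  cabs (cintegral mu D (integrand K f p)) <= 2 * B.
Proof.
have [i1 l1] := dominated_integrable measurable_Re_integrand
  (fun q _ => norm_Re_le_cabs (integrand K f p q)).
have [i2 l2] := dominated_integrable measurable_Im_integrand
  (fun q _ => norm_Im_le_cabs (integrand K f p q)).
split => //; apply: (le_trans (cabs_le _)); rewrite /cintegral /=.
by move: l1 l2; lra.
Qed.

End integrand.

Lemma cabs_RtoCM (r : R) (w : R[i]) : 0 <= r -> cabs (RtoC r * w) = r * cabs w.
Proof.
case: w => x y r0; rewrite /RtoC /cabs; simpc => /=.
by rewrite !exprMn -mulrDr sqrtrM ?sqr_ge0// sqrtr_sqr ger0_norm.
Qed.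

(** The factors [rho z ^ a.1] and [rho w ^ a.2] of the operator cancel the negative powers in
    [integral_kmod_le]. Convergence and the bound hold at every point of T_B x T_B. *)
Theorem bounded_of_cond (a alpha : R * R) : 0 <= a.1 -> 0 < a.2 -> alpha.1 <= b.1 ->
  -1 < b.2 -> c.1 = a.1 + b.1 - alpha.1 -> c.2 = m.+1%:R + 1 + a.2 + b.2 ->
  bounded_1inf_to_inf mu alpha a K.
Proof.
move=> a10 a20 ab b21 c1E c2E.
have [C C0 hC] := integral_kmod_le a10 a20 ab b21 c1E c2E.
exists (2 * C) => f mf Mfin; have M0 := mixed_norm_ge0 alpha.1 f.
set M := mixed_norm_1inf _ _ _ in M0 Mfin *.
have Mf : M \is a fin_num by rewrite ge0_fin_numE.
pose B (p : X * X) := C * (rho p.1 `^ (- a.1) * rho p.2 `^ (- a.2)) * fine M.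
have hB p : D p -> (\int[(mu \x mu)%E]_(q in D)
    (kmod b c p.1 p.2 q.1 q.2 * cabs (f q))%:E <= (B p)%:E)%E.
  move=> [p1 p2]; apply: le_trans (hC f mf Mfin _ _ p1 p2) _.
  by rewrite -/M -(fineK Mf) -EFinM.
split.
  by apply: nearW => p pD; exact: (cintegrable_cintegral_le mf pD (hB p pD)).1.
apply/ess_supP; apply: nearW => p; rewrite -(fineK Mf) -EFinM.
case: ifPn => [|_]; last by rewrite lee_fin !mulr_ge0// fine_ge0.
rewrite inE => pD; have [_ le] := cintegrable_cintegral_le mf pD (hB p pD).
have [/rho_gt0 r1 /rho_gt0 r2] := pD.
rewrite lee_fin /op cabs_RtoCM ?mulr_ge0 ?powR_ge0//.
apply: (@le_trans _ _ (rho p.1 `^ a.1 * rho p.2 `^ a.2 * (2 * B p))).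
  by apply: ler_wpM2l => //; rewrite mulr_ge0 ?powR_ge0.
rewrite /B !powRN le_eqVlt; apply/orP; left; apply/eqP.
by field; rewrite !gt_eqF// powR_gt0.
Qed.

End sufficiency.

(** * Testing boundedness on indicator functions *)

Section test_functions.
Variables (R : realType) (m : nat).
Local Notation X := (Cn R m.+1).
Local Notation D := (@TB R m.+1 `*` @TB R m.+1).
Variable mu : {sigma_finite_measure set X -> \bar R}.
Hypothesis hmu : is_lebesgue_Cn mu.
Variables (b c : R * R) (K : X -> X -> X -> X -> R[i]) (th : X -> X -> X -> X -> R).
Hypothesis hK : phase_kernel b c K th.

Lemma ae_exists d (T : measurableType d) (nu : {measure set T -> \bar R})
    (P : T -> Prop) (W : set T) :
  (\forall x \ae nu, P x) -> measurable W -> (0 < nu W)%E -> exists2 x, W x & P x.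
Proof.
move=> [A [mA A0 PA]] mW W0; apply: contrapT => H.
have WA : W `<=` A by move=> x Wx; apply: PA => Px; apply: H; exists x.
have : (nu W <= nu A)%E by apply: le_measure; rewrite ?inE.
by rewrite A0 leNgt W0.
Qed.

(** Every section of [E] in the first variable lies in [E1], and the norm is a supremum in the
    second one. Stacking many sets in the second variable therefore costs nothing in the source
    norm. *)
Lemma mixed_norm_indic_le (al A : R) (E1 : set X) (E : set (X * X)) :
  measurable E1 -> measurable E -> (forall q, E q -> E1 q.1) -> E1 `<=` @TB R m.+1 -> 0 <= A ->
  (forall u, E1 u -> rho u `^ al <= A) ->
  (mixed_norm_1inf mu al (fun q => RtoC (\1_E q)) <= A%:E * mu E1)%E.
Proof.
move=> mE1 mE EE1 E1B A0 hA; apply/ess_supP; apply: nearW => w.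
have mTB := @measurable_TB R m.+1.
case: ifPn => _; last by rewrite mule_ge0.
apply: (@le_trans _ _ (\int[mu]_(z in @TB R m.+1) (A%:E * (\1_E1 z)%:E))%E).
  apply: ge0_le_integral => //.
  - by move=> z _; rewrite mule_ge0// lee_fin ?powR_ge0 ?cabs_ge0.
  - apply/measurable_EFinP; apply: measurable_funM; last exact: measurable_rho_powR.
    apply: (@measurable_funS _ _ _ _ setT) => //.
    apply: (@measurable_section R m (fun q => RtoC (\1_E q)) w).
    by split => //=; exact: measurable_indic.
  - by apply/measurable_EFinP; apply: measurable_funM => //; exact: measurable_indic.
  - move=> z zB; rewrite -!EFinM lee_fin /cabs /= expr0n addr0 sqrtr_sqr !indicE.
    have [zE|zE] := boolP ((z, w) \in E); last by rewrite normr0 mul0r mulr_ge0.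
    have zE1 : E1 z by apply: (EE1 (z, w)); move: zE; rewrite inE.
    by rewrite mem_set// normr1 mul1r mulr1; exact: hA.
rewrite ge0_integralZl//; last first.
  by apply/measurable_EFinP; exact: measurable_indic.
by rewrite integral_indic// setIidl.
Qed.

(** The test function is the indicator of the union of the [E1 x F k]. On [W1 x W2] the
    contributions of all the [F k] add up, while the norm is at most [A * mu E1]; the factor [mu E1]
    cancels. *)
Lemma test_bound (a alpha : R * R) : bounded_1inf_to_inf mu alpha a K ->
  exists2 C : R, 0 <= C & forall (E1 W1 W2 : set X) (N : nat) (F : nat -> set X)
      (kap v : nat -> R) (A : R),
    [/\ measurable E1, measurable W1, measurable W2 & forall k, measurable (F k)] ->
    [/\ E1 `<=` @TB R m.+1, W1 `<=` @TB R m.+1, W2 `<=` @TB R m.+1 &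
        forall k, F k `<=` @TB R m.+1] ->
    trivIset setT F ->
    [/\ (0 < mu E1)%E, (mu E1 < +oo)%E, (0 < mu W1)%E & (0 < mu W2)%E] ->
    (forall k, 0 <= kap k) -> (forall k, 0 <= v k) -> 0 <= A ->
    (forall z w u e k, W1 z -> W2 w -> E1 u -> F k e -> 2^-1 <= cos (th z w u e) /\
       kap k <= rho z `^ a.1 * rho w `^ a.2 * kmod b c z w u e) ->
    (forall u, E1 u -> rho u `^ alpha.1 <= A) ->
    (forall k, (v k)%:E <= mu (F k))%E ->
    \sum_(k < N) kap k * v k <= C * A.
Proof.
move=> [C hC]; exists (2 * `|C|) => [|E1 W1 W2 N F kap v A]; first by rewrite mulr_ge0.
move=> [mE1 mW1 mW2 mF] [E1B W1B W2B FB] tF [E10 E1f W10 W20] kap0 v0 A0 hker hA hv.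
pose Fs k := E1 `*` F k; pose s := iota 0 N.
pose E := \big[setU/set0]_(k <- s) Fs k.
have mFs k : measurable (Fs k) by exact: measurableX.
have mE : measurable E by exact: bigsetU_measurable.
have EP q : E q -> E1 q.1 /\ exists k, F k q.2.
  by rewrite /E -bigcup_seq => -[k _ [? ?]]; split => //; exists k.
have ED : E `<=` D by move=> q /EP[/E1B ? [k /FB ?]].
have tFs : trivIset [set` s] Fs.
  move=> i j _ _ [q [[_ qi] [_ qj]]]; apply: (tF i j) => //; by exists q.2.
pose f (q : X * X) : R[i] := RtoC (\1_E q).
have mf : cmeasurable f by split => //=; exact: measurable_indic.
have nf : (mixed_norm_1inf mu alpha.1 f <= A%:E * mu E1)%E.
  by apply: mixed_norm_indic_le => // q /EP[].
have E1fin : mu E1 \is a fin_num by rewrite ge0_fin_numE.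
pose e1 := fine (mu E1); have e1E : mu E1 = e1%:E by rewrite fineK.
have e10 : 0 < e1 by rewrite -lte_fin -e1E.
have [|cv le] := hC f mf.
  by apply: le_lt_trans nf _; rewrite e1E -EFinM ltry.
have {}le : (Linf_norm mu (op mu a K f) <= (`|C| * (A * e1))%:E)%E.
  apply: (le_trans le); apply: (@le_trans _ _ (`|C|%:E * mixed_norm_1inf mu alpha.1 f)%E).
    by apply: lee_wpmul2r; [exact: mixed_norm_ge0|rewrite lee_fin ler_norm].
  by rewrite EFinM; apply: lee_wpmul2l => //; rewrite EFinM -e1E.
have WD : W1 `*` W2 `<=` D by move=> q [/W1B ? /W2B ?].
(* Integrability and the essential bound hold almost everywhere, and [W1 x W2] has positive measure,
   so some point of it satisfies both. *)
have [p [p1 p2] [pint pop]] : exists2 p, (W1 `*` W2) p &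
    cintegrable mu D (integrand K f p) /\ cabs (op mu a K f p) <= `|C| * (A * e1).
  have WW : (0 < (mu \x mu)%E (W1 `*` W2))%E.
    by rewrite product_measure1E//; apply: mule_gt0.
  have [||p Wp [H1 H2]] := @ae_exists _ _ (mu \x mu)%E (fun p =>
     (D p -> cintegrable mu D (integrand K f p)) /\
     ((if p \in D then (cabs (op mu a K f p))%:E else 0%E) <= (`|C| * (A * e1))%:E)%E)
     (W1 `*` W2) _ (measurableX mW1 mW2).
  - by apply: filterI => //; exact/ess_supP.
  - exact: WW.
  - exists p => //; split; first exact/H1/WD.
    by move: H2; rewrite mem_set; [rewrite lee_fin|exact: WD].
have pD : D p by exact: WD.
have [/rho_gt0 rp1 /rho_gt0 rp2] := pD.
pose r := rho p.1 `^ a.1 * rho p.2 `^ a.2.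
have r0 : 0 < r by rewrite mulr_gt0// powR_gt0.
pose g q := complex.Re (integrand K f p q).
have gE q : D q -> g q = kmod b c p.1 p.2 q.1 q.2 * cos (th p.1 p.2 q.1 q.2) * \1_E q.
  by move=> qD; rewrite /g (Re_integrand hK)//= mulr0 addr0.
have g0 q : D q -> 0 <= g q.
  move=> qD; rewrite gE// indicE; have [/set_mem /EP[h1 [k h2]]|_] := boolP (q \in E).
    have [h _] := hker _ _ _ _ _ p1 p2 h1 h2.
    by rewrite mulr1 mulr_ge0 ?kmod_ge0//; lra.
  by rewrite mulr0.
have mg : measurable_fun D g by exact: (measurable_Re_integrand hK).
have mD : measurable D by exact: measurable_D.
(* Only the real part is used: there is no cancellation in it, since the cosine of the phase is at
   least 1/2 on [E]. This is the source of the 2 in the denominator. *)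
have lower : ((\sum_(k < N) kap k * v k) * (e1 / (2 * r)) <= Rintegral (mu \x mu)%E D g).
  rewrite -lee_fin /Rintegral fineK; last by apply: integrable_fin_num => //; exact: pint.1.
  apply: (@le_trans _ _ (\int[(mu \x mu)%E]_(q in E) (g q)%:E)%E); last first.
    by apply: ge0_subset_integral => //; exact/measurable_EFinP.
  rewrite ge0_integral_bigsetU ?iota_uniq//; last 2 first.
  - by apply/measurable_EFinP; apply: measurable_funS mg.
  - by move=> q /ED /g0; rewrite lee_fin.
  rewrite mulr_suml -sumEFin -(big_mkord xpredT (fun k => (kap k * v k * (e1 / (2 * r)))%:E)).
  rewrite /index_iota subn0 -/s big_seq [leRHS]big_seq; apply: lee_sum => k ks.
  have FsE : Fs k `<=` E by move=> q qk; rewrite /E -bigcup_seq; exists k.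
  have muFs : (mu \x mu)%E (Fs k) = (mu E1 * mu (F k))%E by rewrite /Fs product_measure1E.
  apply: (@le_trans _ _ (\int[(mu \x mu)%E]_(q in Fs k) (cst (kap k / (2 * r))%:E q))%E).
    rewrite integral_cst// [X in (_ <= _ * X)%E]muFs e1E.
    have -> : kap k * v k * (e1 / (2 * r)) = kap k / (2 * r) * e1 * v k by ring.
    rewrite muleA -EFinM [leLHS]EFinM; apply: lee_wpmul2l => //.
    by rewrite lee_fin mulr_ge0 ?(ltW e10)// divr_ge0// mulr_ge0// ltW.
  apply: ge0_le_integral => //.
  - by move=> q _; rewrite lee_fin divr_ge0// mulr_ge0// ltW.
  - by apply/measurable_EFinP; apply: measurable_funS mg => // q /FsE /ED.
  - move=> q qk; have [h1 h2] := qk.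
    have [hc hk] := hker _ _ _ _ _ p1 p2 h1 h2.
    rewrite lee_fin gE; last exact/ED/FsE.
    rewrite indicE mem_set; last exact: FsE.
    rewrite mulr1 ler_pdivrMr; last by rewrite mulr_gt0.
    apply: (le_trans hk); rewrite -/r.
    have := kmod_ge0 b c p.1 p.2 q.1 q.2; set kk := kmod _ _ _ _ _ _ => kk0.
    have -> : kk * cos (th p.1 p.2 q.1 q.2) * (2 * r) =
      r * kk * (2 * cos (th p.1 p.2 q.1 q.2)) by ring.
    apply: ler_peMr; first by rewrite mulr_ge0 ?(ltW r0).
    by rewrite mulrC -ler_pdivrMr// mul1r.
have upper : r * Rintegral (mu \x mu)%E D g <= `|C| * (A * e1).
  apply: le_trans pop; rewrite /op cabs_RtoCM ?(ltW r0)// ler_pM2l//.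
  exact: le_trans (Re_le_cabs _).
have : (\sum_(k < N) kap k * v k) * (e1 / 2) <= `|C| * (A * e1).
  apply: le_trans upper.
  have -> : (\sum_(k < N) kap k * v k) * (e1 / 2) =
    r * ((\sum_(k < N) kap k * v k) * (e1 / (2 * r))) by field; rewrite gt_eqF.
  by rewrite ler_pM2l.
have -> : `|C| * (A * e1) = 2 * `|C| * A * (e1 / 2) by field.
by rewrite ler_pM2r// divr_gt0.
Qed.

End test_functions.

(** * Regions near the imaginary axis and the size of rho(z,u) there *)

Section near_imaginary_axis.
Variables (R : realType) (m : nat) (dl : R).
Local Notation X := (Cn R m.+1).
Hypotheses (dl0 : 0 < dl) (dlm : m%:R * dl ^+ 2 <= 8^-1).

(* [r] is the scale of the coordinates, [s <= r] that of the distance [rho z] to the boundary. *)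
Definition near_axis (r s : R) (z : X) : Prop :=
  [/\ forall j : 'I_m, `|xc z j| <= dl * Num.sqrt r /\ `|yc z j| <= dl * Num.sqrt r,
      `|xc z m| <= dl * r & s / 2 <= rho z <= 2 * s].

(** The image of [box 1] under the dilation [(z', z_n) -> (sqrt r z', r z_n)], which preserves T_B
    and multiplies rho by [r]. *)
Definition box (r : R) : set X :=
  cube (fun=> - (dl * Num.sqrt r)) (fun=> - (dl * Num.sqrt r)) (2 * (dl * Num.sqrt r)) `&`
  slab (- (dl * r)) (dl * r) r (2 * r).

Lemma measurable_box r : measurable (box r).
Proof. by apply: measurableI; [exact: measurable_cube|exact: measurable_slab]. Qed.

Lemma TB_rho (z : X) : 0 < rho z -> TB z.
Proof. by rewrite /TB /rho /= subr_gt0. Qed.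

Lemma box_near_axis r z : 0 < r -> box r z -> near_axis r r z.
Proof.
move=> r0 [zc [xz yz]].
have zj (j : 'I_m) : `|xc z j| <= dl * Num.sqrt r /\ `|yc z j| <= dl * Num.sqrt r.
  by have [? ?] := zc j; rewrite !ler_norml; split; lra.
split => //; first by rewrite ler_norml; lra.
have S0 : 0 <= \sum_(j < m) yc z j ^+ 2 by apply: sumr_ge0 => j _; exact: sqr_ge0.
have : \sum_(j < m) yc z j ^+ 2 <= 8^-1 * r.
  apply: (@le_trans _ _ (\sum_(j < m) (dl ^+ 2 * r))).
    apply: ler_sum => j _; have [_ h] := zj j.
    rewrite -(real_normK (num_real (yc z j))) -[X in _ * X](@sqr_sqrtr R r) ?(ltW r0)//.
    by rewrite -exprMn ler_pXn2r// nnegrE ?mulr_ge0 ?sqrtr_ge0// ltW.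
  by rewrite sumr_const card_ord -[leLHS]mulr_natl mulrA ler_pM2r.
by rewrite /rho /=; lra.
Qed.

Lemma near_axis_TB r s z : 0 < s -> near_axis r s z -> TB z.
Proof. by move=> s0 [_ _ h]; apply: TB_rho; lra. Qed.

Lemma shell_near_axis q z : 0 < q -> shell dl q z -> near_axis 1 q z.
Proof.
move=> q0 [zj [xz rz]]; rewrite /near_axis sqrtr1 mulr1.
split => [j||]; last by lra.
  by have [? ?] := zj j; rewrite !ler_norml; split; lra.
by rewrite ler_norml; lra.
Qed.

Lemma sqr_sqrtD_le (r r' : R) : 0 <= r -> 0 <= r' ->
  (Num.sqrt r + Num.sqrt r') ^+ 2 <= 2 * (r + r').
Proof.
move=> h h'; rewrite -[in leRHS](sqr_sqrtr h) -[in leRHS](sqr_sqrtr h').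
by have := sqr_ge0 (Num.sqrt r - Num.sqrt r'); rewrite -subr_ge0 => H; nra.
Qed.

(** With [T = r + r'], the horizontal terms are of order [dl^2 T] and the last real coordinates
    differ by at most [dl T], so the imaginary part is at most [eps T / 8]. The assumption
    [T <= 2 (s + s')] keeps the real part above [T / 8] even when one of the points is much closer
    to the boundary than its scale. *)
Lemma near_axis_rho2 (eps r s r' s' : R) (z u : X) :
  0 < eps <= 1 -> 2 * (m%:R * dl ^+ 2) + dl <= eps / 4 ->
  0 < s <= r -> 0 < s' <= r' -> r + r' <= 2 * (s + s') ->
  near_axis r s z -> near_axis r' s' u ->
  `|complex.Im (rho2 z u)| <= eps * complex.Re (rho2 z u) /\
  (r + r') / 8 <= cabs (rho2 z u) <= 8 * (r + r').
Proof.
move=> /andP[e0 e1] dle /andP[s0 sr] /andP[s'0 sr'] rs [zj zm rz] [uj um ru].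
set T := r + r'; have T0 : 0 < T by rewrite /T; lra.
pose q := dl * Num.sqrt r + dl * Num.sqrt r'.
have q0 : 0 <= q by rewrite addr_ge0// mulr_ge0 ?sqrtr_ge0// ltW.
have q2 : q ^+ 2 <= 2 * dl ^+ 2 * T.
  have -> : 2 * dl ^+ 2 * T = dl ^+ 2 * (2 * T) by ring.
  rewrite /q -mulrDr exprMn ler_pM2l ?exprn_gt0//.
  by apply: sqr_sqrtD_le; lra.
have mq : m%:R * q ^+ 2 <= 2 * (m%:R * dl ^+ 2) * T.
  have -> : 2 * (m%:R * dl ^+ 2) * T = m%:R * (2 * dl ^+ 2 * T) by ring.
  exact: ler_wpM2l.
have hx (j : 'I_m) : `|xc z j - xc u j| <= q.
  have [h1 _] := zj j; have [h2 _] := uj j.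
  by apply: le_trans (ler_normB _ _) _; exact: lerD.
have hy (j : 'I_m) : `|yc z j - yc u j| <= q.
  have [_ h1] := zj j; have [_ h2] := uj j.
  by apply: le_trans (ler_normB _ _) _; exact: lerD.
have hy' (j : 'I_m) : `|yc z j + yc u j| <= q.
  have [_ h1] := zj j; have [_ h2] := uj j.
  by apply: le_trans (ler_normD _ _) _; exact: lerD.
have sq x : `|x| <= q -> x ^+ 2 <= q ^+ 2.
  by move=> h; rewrite -(real_normK (num_real x)) ler_pXn2r// nnegrE.
have hd : hdist2 z u <= 2 * (m%:R * q ^+ 2).
  apply: (@le_trans _ _ (\sum_(j < m) (2 * q ^+ 2))).
    apply: ler_sum => j _; have := sq _ (hx j); have := sq _ (hy j).
    by move=> ? ?; rewrite [leRHS]mulr_natl mulr2n; exact: lerD.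
  by rewrite sumr_const card_ord -[leLHS]mulr_natl mulrCA.
have hs : `|hshear z u| <= m%:R * q ^+ 2.
  apply: le_trans (ler_norm_sum _ _ _) _.
  apply: (@le_trans _ _ (\sum_(j < m) (q ^+ 2))).
    by apply: ler_sum => j _; rewrite normrM expr2; apply: ler_pM.
  by rewrite sumr_const card_ord -[leLHS]mulr_natl.
have d0 := hdist2_ge0 z u.
have TE : T = r + r' by [].
have ReL : T / 8 <= complex.Re (rho2 z u) by rewrite Re_rho2; lra.
have mdl : 2 * (m%:R * dl ^+ 2) * T <= 4^-1 * T.
  by rewrite ler_pM2r//; move: (m%:R * dl ^+ 2) dlm => y; lra.
have ReU : complex.Re (rho2 z u) <= 2 * T by rewrite Re_rho2; lra.
have hm : `|xc z m - xc u m| <= dl * T.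
  by rewrite /T mulrDr; apply: le_trans (ler_normB _ _) _; exact: lerD.
have ImU : `|complex.Im (rho2 z u)| <= eps / 8 * T.
  rewrite Im_rho2 normrM ger0_norm; last by lra.
  have h1 := le_trans (ler_normB (hshear z u) (xc z m - xc u m)) (lerD hs hm).
  have h2 : (2 * (m%:R * dl ^+ 2) + dl) * T <= eps / 4 * T by rewrite ler_pM2r.
  by rewrite mulrDl in h2; move: h1; rewrite /=; lra.
have eT : eps * (T / 8) <= eps * complex.Re (rho2 z u) by rewrite ler_pM2l.
split; first lra.
apply/andP; split; first exact: le_trans ReL (Re_le_cabs _).
apply: le_trans (cabs_le _) _; rewrite ger0_norm; last by lra.
have : eps * T <= T by rewrite ler_piMl// ltW.
by lra.
Qed.

Lemma mu_box (mu : {measure set X -> \bar R}) r : is_lebesgue_Cn mu -> 0 < r ->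
  mu (box r) = ((4 * dl ^+ 2) ^+ m * (2 * dl) * r ^+ m.+2)%:E.
Proof.
move=> hmu r0; have sr : 0 <= dl * Num.sqrt r by rewrite mulr_ge0 ?sqrtr_ge0// ltW.
have dr : 0 < dl * r by rewrite mulr_gt0.
rewrite mu_cube_slab//; [|lra..].
have -> : (2 * (dl * Num.sqrt r)) ^+ 2 = 4 * dl ^+ 2 * r.
  by rewrite !exprMn sqr_sqrtr ?(ltW r0)//; ring.
by congr EFin; rewrite [(_ * r) ^+ m]exprMn !exprS; ring.
Qed.

End near_imaginary_axis.

(** * Unboundedness of powers and of sums of large terms *)

Section powR_growth.
Variable R : realType.

Lemma powR_bounded_le0 (e C : R) : (forall t, 1 <= t -> t `^ e <= C) -> e <= 0.
Proof.
move=> H; rewrite leNgt; apply/negP => e0.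
have C1 : 1 <= `|C| + 1 by rewrite lerDr.
(* At this [t] the power [t^e] equals [|C| + 1], which exceeds [C]. *)
have t1 : 1 <= (`|C| + 1) `^ e^-1.
  by rewrite -[leLHS](powRr0 (`|C| + 1)) ler_powR// invr_ge0 ltW.
have := H _ t1; rewrite -powRrM mulVf ?gt_eqF// powRr1; last by lra.
by have := ler_norm C; lra.
Qed.

Lemma powR_bounded_ge0 (e C : R) : (forall t, 0 < t <= 1 -> t `^ e <= C) -> 0 <= e.
Proof.
move=> H; rewrite -oppr_le0; apply: (@powR_bounded_le0 _ C) => t t1.
have t0 : 0 < t by exact: lt_le_trans t1.
have := H t^-1; rewrite invr_gt0 t0 invf_le1// t1 => /(_ isT).
by rewrite -powR_inv1 ?(ltW t0)// -powRrM mulN1r.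
Qed.

Lemma sum_ge_const_false (f : nat -> R) (e C : R) : 0 < e -> (forall k, e <= f k) ->
  (forall N, \sum_(k < N) f k <= C) -> False.
Proof.
move=> e0 fe H; have [N [_ CN]] := exists_nat_ge (C + 1) e0.
have : N%:R * e <= \sum_(k < N) f k.
  rewrite mulr_natl -[N in leLHS](card_ord N) -sumr_const.
  by apply: ler_sum => k _; exact: fe.
by have := H N; lra.
Qed.

End powR_growth.

(** * Disjointness of dyadic layers *)

Section dyadic_disjoint.

Lemma trivIset_dyadic_up (R : realType) (T : Type) (F : nat -> set T) (g : T -> R) :
  (forall k z, F k z -> 2 ^+ k < g z <= 2 * 2 ^+ k) -> trivIset setT F.
Proof.
move=> H i j _ _ [z [/H/andP[i1 i2] /H/andP[j1 j2]]].
have K (k l : nat) : 2 ^+ k < g z -> g z <= 2 * 2 ^+ l -> (k <= l)%N.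
  move=> h1 h2; rewrite -ltnS -(@ltr_eXn2l _ (2 : R)) ?ltr1n// exprS.
  exact: lt_le_trans h1 h2.
by apply/eqP; rewrite eqn_leq !K.
Qed.

Lemma trivIset_dyadic_down (R : realType) (T : Type) (F : nat -> set T) (g : T -> R) :
  (forall k z, F k z -> 2^-1 ^+ k < g z <= 2 * 2^-1 ^+ k) -> trivIset setT F.
Proof.
move=> H i j _ _ [z [/H/andP[i1 i2] /H/andP[j1 j2]]].
have K (k l : nat) : 2^-1 ^+ k < g z -> g z <= 2 * 2^-1 ^+ l -> (l <= k)%N.
  move=> h1 h2; have := lt_le_trans h1 h2; rewrite !exprVn ltr_pdivlMr ?exprn_gt0//.
  rewrite mulrC ltr_pdivrMr ?exprn_gt0// -exprS ltr_eXn2l ?ltr1n// ltnS//.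
by apply/eqP; rewrite eqn_leq !K.
Qed.

End dyadic_disjoint.

(** * Necessity of the exponent conditions *)

Section necessity.
Variables (R : realType) (m : nat).
Local Notation X := (Cn R m.+1).
Variable mu : {sigma_finite_measure set X -> \bar R}.
Hypothesis hmu : is_lebesgue_Cn mu.
Variables (b c : R * R) (K : X -> X -> X -> X -> R[i]) (th : X -> X -> X -> X -> R).
Hypothesis hK : phase_kernel b c K th.
Variables (a alpha : R * R).
Hypothesis hbd : bounded_1inf_to_inf mu alpha a K.

(* Sizes, up to constants, of the operator kernel between [near_axis] regions; in
   [gauge1] the weight [rho^alpha_1] of the source norm is divided out. *)
Definition gauge1 (r s : R) : R := r `^ a.1 * s `^ (b.1 - alpha.1) * (r + s) `^ (- c.1).
Definition gauge2 (r t s : R) : R := r `^ a.2 * s `^ b.2 * (r + t) `^ (- c.2).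

Lemma powR8_comparable (x y e : R) : 0 < y -> y / 8 <= x <= 8 * y ->
  8 `^ (- `|e|) * y `^ e <= x `^ e <= 8 `^ `|e| * y `^ e.
Proof. by move=> y0 h; apply: powR_comparable => //; lra. Qed.

Lemma aperture (eps : R) : 0 < eps <= 1 -> exists dl : R, [/\ 0 < dl,
  m%:R * dl ^+ 2 <= 8^-1 & 2 * (m%:R * dl ^+ 2) + dl <= eps / 4].
Proof.
move=> /andP[e0 e1]; pose M : R := m%:R + 1.
have m0 : 0 <= m%:R :> R by exact: ler0n.
have M1 : 1 <= M by rewrite /M lerDr.
have M0 : 0 < M by lra.
(* Dividing by [m + 1] makes [m dl^2] at most [eps / 256] and [dl] at most [eps / 16], for [m = 0]
   as well. *)
pose dl := eps / 16 / M.
have dl0 : 0 < dl by rewrite !divr_gt0.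
have dlM : M * dl = eps / 16 by rewrite /dl mulrC divfK ?gt_eqF.
have dle : dl <= eps / 16 by rewrite -dlM ler_peMl// ltW.
have mdl : m%:R * dl <= eps / 16 by rewrite -dlM ler_wpM2r ?(ltW dl0)// /M lerDl.
have mdl2 : m%:R * dl ^+ 2 <= eps / 16 * (1 / 16).
  rewrite expr2 mulrA; apply: ler_pM => //; [exact: mulr_ge0 (ltW _)|exact: ltW|lra].
by exists dl; split => //; move: (m%:R * dl ^+ 2) mdl2 => y; lra.
Qed.

(** [test_bound] with boxes of scales [s1], [r1], [r2] for [E1], [W1], [W2]: there [near_axis_rho2]
    makes every factor of the kernel comparable to a power of the scales, uniformly in them.
    Dividing by the bound for the weight on [E1] leaves the gauges. *)
Lemma scale_bound : exists dl C : R, [/\ 0 < dl, m%:R * dl ^+ 2 <= 8^-1 &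
  forall (r1 s1 r2 : R) (N : nat) (F : nat -> set X) (t s v : nat -> R),
    0 < r1 -> 0 < s1 -> 0 < r2 -> (forall k, measurable (F k)) -> trivIset setT F ->
    (forall k, 0 < s k <= t k) -> (forall k, r2 + t k <= 2 * (r2 + s k)) ->
    (forall k z, F k z -> near_axis dl (t k) (s k) z) ->
    (forall k, 0 <= v k) -> (forall k, (v k)%:E <= mu (F k))%E ->
    \sum_(k < N) gauge1 r1 s1 * gauge2 r2 (t k) (s k) * v k <= C].
Proof.
have [C C0 hC] := test_bound hmu hK hbd.
have [eps0 eps0_gt0 hcos] := cos_phase_ge hK.
pose eps := Num.min eps0 1.
have eps01 : 0 < eps <= 1 by rewrite lt_min eps0_gt0 ltr01 ge_min lexx orbT.
have epsle : eps <= eps0 by rewrite ge_min lexx.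
have [dl [dl0 dlm dle]] := aperture eps01.
pose L (e : R) : R := 8 `^ (- `|e|).
have L0 e : 0 < L e by rewrite powR_gt0.
(* One loss [8^(-|e|)] for each of the six powers in the kernel and its prefactor. *)
pose K0 := L a.1 * L a.2 * (L b.1 * L b.2) * (L (- c.1) * L (- c.2)).
have K00 : 0 < K0 by rewrite !mulr_gt0.
exists dl, (C * 8 `^ `|alpha.1| / K0); split => // r1 s1 r2 N F t s v.
move=> r10 s10 r20 mF tF hs hts hF v0 hv.
have nr1 (z : X) : box dl r1 z -> near_axis dl r1 r1 z by exact: (box_near_axis dl0 dlm).
have ns1 (z : X) : box dl s1 z -> near_axis dl s1 s1 z by exact: (box_near_axis dl0 dlm).
have nr2 (z : X) : box dl r2 z -> near_axis dl r2 r2 z by exact: (box_near_axis dl0 dlm).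
have s0 k : 0 < s k by case/andP: (hs k).
pose kap k := K0 * (r1 `^ a.1 * r2 `^ a.2 * (s1 `^ b.1 * s k `^ b.2) *
  ((r1 + s1) `^ (- c.1) * (r2 + t k) `^ (- c.2))).
have mub r : 0 < r -> (0 < mu (box dl r))%E /\ (mu (box dl r) < +oo)%E.
  move=> r0; rewrite mu_box// ltry; split => //.
  by rewrite lte_fin; apply: mulr_gt0; rewrite ?exprn_gt0// mulr_gt0 ?exprn_gt0// mulr_gt0 ?exprn_gt0.
have := @hC (box dl s1) (box dl r1) (box dl r2) N F kap v (8 `^ `|alpha.1| * s1 `^ alpha.1).
have -> : \sum_(k < N) gauge1 r1 s1 * gauge2 r2 (t k) (s k) * v k =
    (\sum_(k < N) kap k * v k) * (s1 `^ (- alpha.1) / K0).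
  rewrite mulr_suml; apply: eq_bigr => k _; rewrite /gauge1 /gauge2 powR_addr// /kap.
  have := gt_eqF K00; move: (s1 `^ (- _)) => y1; move: (K0) => y2 y20.
  by field; rewrite y20.
move=> H; rewrite -ler_pdivlMr; last by rewrite divr_gt0// powR_gt0.
have -> : C * 8 `^ `|alpha.1| / K0 / (s1 `^ (- alpha.1) / K0) =
    C * (8 `^ `|alpha.1| * s1 `^ alpha.1).
  by rewrite powRN; field; rewrite !gt_eqF// ?powR_gt0.
apply: H => //.
- by split => //; exact: measurable_box.
- split.
  + by move=> z /ns1 /near_axis_TB; exact.
  + by move=> z /nr1 /near_axis_TB; exact.
  + by move=> z /nr2 /near_axis_TB; exact.
  + by move=> k z /hF /near_axis_TB; exact.
- by have [? ?] := mub _ s10; have [? _] := mub _ r10; have [? _] := mub _ r20.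
- by move=> k; rewrite !mulr_ge0 ?powR_ge0 ?(ltW K00).
- by rewrite mulr_ge0 ?powR_ge0.
- move=> z w u e k /nr1 nz /nr2 nw /ns1 nu /hF ne.
  have zB := near_axis_TB r10 nz; have wB := near_axis_TB r20 nw.
  have uB := near_axis_TB s10 nu; have eB := near_axis_TB (s0 k) ne.
  have [Im1 c1] : `|complex.Im (rho2 z u)| <= eps * complex.Re (rho2 z u) /\
      (r1 + s1) / 8 <= cabs (rho2 z u) <= 8 * (r1 + s1).
    by apply: (near_axis_rho2 dl0 dlm eps01 dle _ _ _ nz nu); lra.
  have [Im2 c2] : `|complex.Im (rho2 w e)| <= eps * complex.Re (rho2 w e) /\
      (r2 + t k) / 8 <= cabs (rho2 w e) <= 8 * (r2 + t k).
    by apply: (near_axis_rho2 dl0 dlm eps01 dle _ _ _ nw ne) => //; lra.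
  have Re1 := Re_rho2_gt0 zB uB; have Re2 := Re_rho2_gt0 wB eB.
  split.
    apply: hcos => //.
      by apply: le_trans Im1 _; rewrite ler_pM2r.
    by apply: le_trans Im2 _; rewrite ler_pM2r.
  have -> : kap k = (L a.1 * r1 `^ a.1) * (L a.2 * r2 `^ a.2) *
     ((L b.1 * s1 `^ b.1) * (L b.2 * s k `^ b.2) *
     ((L (- c.1) * (r1 + s1) `^ (- c.1)) * (L (- c.2) * (r2 + t k) `^ (- c.2)))).
    rewrite /kap /K0; move: (L _) (L _) (L _) (L _) (L _) (L _) => *; ring.
  rewrite /kmod invfM -!powRN.
  have P x y e' : 0 < y -> y / 8 <= x <= 8 * y -> L e' * y `^ e' <= x `^ e'.
    by move=> y0 h; have /andP[] := powR8_comparable e' y0 h.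
  have tk := hs k.
  have [_ _ rz] := nz; have [_ _ rw] := nw; have [_ _ ru] := nu; have [_ _ re] := ne.
  do 3 ?[apply: ler_pM; rewrite ?mulr_ge0 ?powR_ge0 ?(ltW (L0 _))//]; apply: P => //; lra.
- move=> u /ns1 [_ _ ru].
  have h : s1 / 8 <= rho u <= 8 * s1 by lra.
  by case/andP: (powR8_comparable alpha.1 s10 h).
Qed.

Lemma powR1D_ge (e t : R) : 0 < t <= 1 -> 2 `^ (- `|e|) <= (1 + t) `^ e.
Proof.
move=> t01; have /andP[h _] : 2 `^ (- `|e|) * 1 `^ e <= (1 + t) `^ e <= 2 `^ `|e| * 1 `^ e.
  by apply: powR_comparable => //; lra.
by move: h; rewrite powR1 mulr1.
Qed.

Lemma single_scale_bound : exists C : R, forall r1 s1 r2 s2 : R,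
  0 < r1 -> 0 < s1 -> 0 < r2 -> 0 < s2 ->
  gauge1 r1 s1 * gauge2 r2 s2 s2 * s2 `^ m.+2%:R <= C.
Proof.
have [dl [C [dl0 dlm H]]] := scale_bound.
pose V := (4 * dl ^+ 2) ^+ m * (2 * dl).
have V0 : 0 < V by rewrite mulr_gt0 ?exprn_gt0 ?mulr_gt0 ?exprn_gt0.
exists (C / V) => r1 s1 r2 s2 r10 s10 r20 s20.
(* A single box, continued by empty sets to fit the sequence format. *)
pose F k : set X := if k is 0%N then box dl s2 else set0.
pose v k : R := if k is 0%N then V * s2 ^+ m.+2 else 0.
have := H r1 s1 r2 1%N F (fun=> s2) (fun=> s2) v r10 s10 r20.
rewrite big_ord1 /= ler_pdivlMr// powR_mulrn ?(ltW s20)//.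
have -> : gauge1 r1 s1 * gauge2 r2 s2 s2 * s2 ^+ m.+2 * V =
  gauge1 r1 s1 * gauge2 r2 s2 s2 * (V * s2 ^+ m.+2) by ring.
apply.
- by case => [|k] //=; exact: measurable_box.
- by move=> [|i] [|j] _ _ [z []].
- by move=> _; rewrite s20 lexx.
- by move=> _; lra.
- by case => [|k] z //=; exact: (box_near_axis dl0 dlm).
- by case => [|k] //=; rewrite mulr_ge0 ?(ltW V0)// exprn_ge0// ltW.
- by case => [|k] //=; rewrite mu_box.
Qed.

Lemma gauge1_bound : exists C : R, forall r s, 0 < r -> 0 < s -> gauge1 r s <= C.
Proof.
have [C H] := single_scale_bound; exists (C / gauge2 1 1 1) => r s r0 s0.
have g0 : 0 < gauge2 1 1 1 by rewrite !mulr_gt0// powR_gt0// addr_gt0.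
have := H r s 1 1 r0 s0 ltr01 ltr01; rewrite powR1 mulr1.
by rewrite ler_pdivlMr.
Qed.

(** At [r = s = t] the gauge is a constant times a pure power of [t]; a power bounded both as [t]
    tends to 0 and to infinity has exponent 0. *)
Lemma exponent_c1 : c.1 = a.1 + b.1 - alpha.1.
Proof.
have [C H] := gauge1_bound.
have bd t : 0 < t -> t `^ (a.1 + b.1 - alpha.1 - c.1) <= C * 2 `^ c.1.
  move=> t0; have := H t t t0 t0; rewrite /gauge1.
  have -> : t + t = 2 * t by ring.
  rewrite powRM ?(ltW t0)// -(@ler_pM2r _ (2 `^ c.1)) ?powR_gt0//.
  have -> : t `^ a.1 * t `^ (b.1 - alpha.1) * (2 `^ (- c.1) * t `^ (- c.1)) * 2 `^ c.1 =
     t `^ a.1 * t `^ (b.1 - alpha.1) * t `^ (- c.1).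
    by rewrite [2 `^ (- _)]powRN; field; rewrite gt_eqF// powR_gt0.
  by rewrite -!powR_addr// [_ + (_ - _)]addrA.
suff : a.1 + b.1 - alpha.1 - c.1 = 0 by move/eqP; rewrite subr_eq0 => /eqP.
apply/eqP; rewrite eq_le (@powR_bounded_le0 _ _ (C * 2 `^ c.1)).
  rewrite (@powR_bounded_ge0 _ _ (C * 2 `^ c.1))// => t /andP[t0 _]; exact: bd.
by move=> t t1; apply: bd; lra.
Qed.

(** Let [r = t] tend to 0 with [s = 1]: the sum [r + s] stays between 1 and 2, so [t ^ a.1] must
    stay bounded. [exponent_b1] exchanges the roles of [r] and [s]. *)
Lemma exponent_a1 : 0 <= a.1.
Proof.
have [C H] := gauge1_bound; apply: (@powR_bounded_ge0 _ _ (C / 2 `^ (- `|- c.1|))) => t t01.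
have t0 : 0 < t by lra.
have := H t 1 t0 ltr01; rewrite /gauge1 powR1 mulr1 ler_pdivlMr ?powR_gt0//.
apply: le_trans; rewrite ler_pM2l ?powR_gt0// [t + 1]addrC; exact: powR1D_ge.
Qed.

Lemma exponent_b1 : alpha.1 <= b.1.
Proof.
have [C H] := gauge1_bound; rewrite -subr_ge0.
apply: (@powR_bounded_ge0 _ _ (C / 2 `^ (- `|- c.1|))) => t t01.
have t0 : 0 < t by lra.
have := H 1 t ltr01 t0; rewrite /gauge1 powR1 mul1r ler_pdivlMr ?powR_gt0//.
by apply: le_trans; rewrite ler_pM2l ?powR_gt0//; exact: powR1D_ge.
Qed.

(** Homogeneity again, at [r2 = s2 = t]; the box volume [t^(m+2)] now enters because the norm is a
    supremum, not an integral, in the second variable. *)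
Lemma exponent_c2 : c.2 = m.+1%:R + 1 + a.2 + b.2.
Proof.
have [C H] := single_scale_bound.
have g0 : 0 < gauge1 1 1 by rewrite !mulr_gt0// powR_gt0// addr_gt0.
pose e := a.2 + b.2 - c.2 + m.+2%:R.
have bd t : 0 < t -> t `^ e <= C / gauge1 1 1 * 2 `^ c.2.
  move=> t0; have := H 1 1 t t ltr01 ltr01 t0 t0.
  rewrite -mulrA mulrC -ler_pdivlMr// => h.
  rewrite -ler_pdivrMr ?powR_gt0//; apply: le_trans h.
  rewrite /gauge2; have -> : t + t = 2 * t by ring.
  rewrite powRM ?(ltW t0)// -powRN /e !(@powR_addr _ t)//.
  by rewrite le_eqVlt; apply/orP; left; apply/eqP; ring.
suff : e = 0 by rewrite /e -natr1; lra.
apply/eqP; rewrite eq_le (@powR_bounded_le0 _ _ (C / gauge1 1 1 * 2 `^ c.2)).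
  rewrite (@powR_bounded_ge0 _ _ (C / gauge1 1 1 * 2 `^ c.2))// => t /andP[t0 _].
  exact: bd.
by move=> t t1; apply: bd; lra.
Qed.

(** Seen from scale 1, the box of scale [2^k] contributes about [2^(-k a.2)], by [exponent_c2]. For
    [a.2 <= 0] these contributions are bounded below, and summing over disjoint boxes contradicts
    boundedness. *)
Lemma exponent_a2 : 0 < a.2.
Proof.
have [dl [C [dl0 dlm H]]] := scale_bound; rewrite ltNge; apply/negP => a20.
pose V := (4 * dl ^+ 2) ^+ m * (2 * dl).
have V0 : 0 < V by rewrite mulr_gt0 ?exprn_gt0 ?mulr_gt0 ?exprn_gt0.
have g0 : 0 < gauge1 1 1 by rewrite !mulr_gt0// powR_gt0// addr_gt0.
pose x k : R := 2 ^+ k; have x0 k : 0 < x k by rewrite exprn_gt0.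
have x1 k : 1 <= x k by rewrite exprn_ege1// ler1n.
pose f k := gauge1 1 1 * gauge2 1 (x k) (x k) * (V * x k ^+ m.+2).
pose e := gauge1 1 1 * V * 2 `^ (- `|- c.2|).
have e0 : 0 < e by apply: mulr_gt0; [exact: mulr_gt0|exact: powR_gt0].
apply: (@sum_ge_const_false _ f e C) => //.
  move=> k; rewrite /f /e /gauge2 powR1 mul1r.
  have /andP[h _] : 2 `^ (- `|- c.2|) * x k `^ (- c.2) <= (1 + x k) `^ (- c.2) <=
      2 `^ `|- c.2| * x k `^ (- c.2).
    by apply: powR_comparable => //; have := x1 k; have := x0 k; lra.
  have -> : gauge1 1 1 * (x k `^ b.2 * (1 + x k) `^ (- c.2)) * (V * x k ^+ m.+2) =
    gauge1 1 1 * V * ((1 + x k) `^ (- c.2) * (x k `^ b.2 * x k ^+ m.+2)) by ring.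
  rewrite ler_pM2l; last exact: mulr_gt0.
  apply: (@le_trans _ _ (2 `^ (- `|- c.2|) * x k `^ (- c.2) * (x k `^ b.2 * x k ^+ m.+2))).
    rewrite -[leLHS]mulr1 -mulrA ler_pM2l ?powR_gt0//.
    rewrite -powR_mulrn ?(ltW (x0 k))// -!powR_addr// -[leLHS](powRr0 (x k)).
    by apply: ler_powR => //; rewrite exponent_c2 -[m.+2%:R]natr1; lra.
  by apply: ler_wpM2r; rewrite // mulr_ge0 ?powR_ge0// exprn_ge0// ltW.
move=> N; apply: (H 1 1 1 N (fun k => box dl (x k)) x x (fun k => V * x k ^+ m.+2)) => //.
- by move=> k; exact: measurable_box.
- by apply: (@trivIset_dyadic_up R _ _ (fun z : X => yc z m)) => k z [_ []].
- by move=> k; rewrite x0 lexx.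
- by move=> k; have := x0 k; lra.
- by move=> k z; exact: (box_near_axis dl0 dlm).
- by move=> k; rewrite mulr_ge0 ?(ltW V0)// exprn_ge0// ltW.
- by move=> k; rewrite mu_box.
Qed.

(** Layers at height [2^(-k)] over a fixed piece of the boundary have volume of order [2^(-k)] and
    contribute about [2^(-k (b.2 + 1))], bounded below when [b.2 <= -1]. Here the coordinate scale
    stays 1 while the distance to the boundary tends to 0. *)
Lemma exponent_b2 : -1 < b.2.
Proof.
have [dl [C [dl0 dlm H]]] := scale_bound; rewrite ltNge; apply/negP => b21.
pose V := ((2 * dl) ^+ 2) ^+ m * dl.
have V0 : 0 < V by rewrite mulr_gt0 ?exprn_gt0 ?mulr_gt0.
have g0 : 0 < gauge1 1 1 by rewrite !mulr_gt0// powR_gt0// addr_gt0.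
pose x k : R := 2^-1 ^+ k; have x0 k : 0 < x k by rewrite exprn_gt0 ?invr_gt0.
have x1 k : x k <= 1 by rewrite exprn_ile1 ?invr_ge0// invf_le1// ler1n.
pose f k := gauge1 1 1 * gauge2 1 1 (x k) * (V * x k).
pose e := gauge1 1 1 * V * (1 + 1) `^ (- c.2).
have e0 : 0 < e by apply: mulr_gt0; [exact: mulr_gt0|rewrite powR_gt0// addr_gt0].
apply: (@sum_ge_const_false _ f e C) => //.
  move=> k; rewrite /f /e /gauge2 powR1 mul1r.
  have -> : gauge1 1 1 * (x k `^ b.2 * (1 + 1) `^ (- c.2)) * (V * x k) =
    gauge1 1 1 * V * (1 + 1) `^ (- c.2) * (x k `^ b.2 * x k) by ring.
  apply: ler_peMr; first exact: ltW.
  rewrite -[X in _ * X](@powRr1 R) ?(ltW (x0 k))// -powR_addr// -[leLHS](powRr0 (x k)).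
  by apply: ger_powR; [rewrite x0 x1|lra].
move=> N; apply: (H 1 1 1 N (fun k => shell dl (x k)) (fun=> 1) x (fun k => V * x k)) => //.
- by move=> k; exact: measurable_shell.
- by apply: (@trivIset_dyadic_down R _ _ (@rho R m.+1)) => k z [_ []].
- by move=> k; rewrite x0 x1.
- by move=> k; have := x0 k; lra.
- by move=> k z; exact: shell_near_axis.
- by move=> k; rewrite mulr_ge0 ?(ltW V0)// ltW.
- by move=> k; rewrite /V -mulrA; exact: mu_shell_ge.
Qed.

End necessity.

(** * The equivalences for S and T *)

Theorem theorem6p10 (R : realType) (n : nat) (hn : (0 < n)%N)
    (mu : {sigma_finite_measure set (Cn R n) -> \bar R})
    (hmu : is_lebesgue_Cn mu)
    (a b c alpha : R * R) (halpha : -1 < alpha.1 /\ -1 < alpha.2) :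
  let cond3 := 0 <= a.1 /\ 0 < a.2 /\ alpha.1 <= b.1 /\ -1 < b.2 /\
                 c.1 = a.1 + b.1 - alpha.1 /\ c.2 = n%:R + 1 + a.2 + b.2 in
  (bounded_1inf_to_inf mu alpha a (kerS b c) <-> cond3) /\
  (bounded_1inf_to_inf mu alpha a (kerT b c) <-> cond3).
Proof.
case: n hn mu hmu => // m _ mu hmu /=.
(* Both kernels share the modulus [kmod] and differ only in phase, so one equivalence for
   [phase_kernel] yields the two claims. *)
have equiv K th : phase_kernel b c K th -> bounded_1inf_to_inf mu alpha a K <->
    0 <= a.1 /\ 0 < a.2 /\ alpha.1 <= b.1 /\ -1 < b.2 /\
    c.1 = a.1 + b.1 - alpha.1 /\ c.2 = m.+1%:R + 1 + a.2 + b.2.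
  move=> hK; split => [hbd|[a1 [a2 [b1 [b2 [c1 c2]]]]]]; last exact: (bounded_of_cond hmu hK).
  do 5 ?split.
  - exact: (exponent_a1 hmu hK hbd).
  - exact: (exponent_a2 hmu hK hbd).
  - exact: (exponent_b1 hmu hK hbd).
  - exact: (exponent_b2 hmu hK hbd).
  - exact: (exponent_c1 hmu hK hbd).
  - exact: (exponent_c2 hmu hK hbd).
by split; apply: equiv; [exact: kerS_phase|exact: kerT_phase].
Qed.
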